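(* Let $G$ be a Lie group acting on $TT^*G\simeq(G\circledS\mathfrak g_1^* )\circledS(\mathfrak g_2\circledS\mathfrak g_3^* )$ by $((g,\mu,\xi,\nu);h)\mapsto(gh,\mu,\xi,\nu)$. The Poisson reduction of $TT^*G$ (with the Tulczyjew symplectic form) under the action of $G$ results in the total space $\mathfrak g_1^*\circledS(\mathfrak g_2\circledS\mathfrak g_3^* )$ endowed with the Poisson bracket $$\{E,F\}(\mu,\xi,\nu)=\Big\langle\frac{\delta F}{\delta\xi},\frac{\delta E}{\delta\mu}\Big\rangle-\Big\langle\frac{\delta E}{\delta\xi},\frac{\delta F}{\delta\mu}\Big\rangle+\Big\langle\nu,\Big[\frac{\delta E}{\delta\nu},\frac{\delta F}{\delta\nu}\Big]\Big\rangle .$$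
   Context: $G$ is a (finite-dimensional) Lie group with identity $e$, $\mathfrak g=T_eG$; $\mathfrak g_i,\mathfrak g_i^*$ are copies of $\mathfrak g,\mathfrak g^*$. $R_g$ is right multiplication. In this statement the bracket $[\xi,\eta]$ on $\mathfrak g$ is the one determined by right invariant vector fields: if $X_\xi(g)=T_eR_g\xi$, then $[X_\xi,X_\eta]_{JL}=X_{[\xi,\eta]}$ (Jacobi-Lie bracket of vector fields). $\mathrm{ad}^*_\xi:\mathfrak g^*\to\mathfrak g^*$ is the linear dual: $\langle\mathrm{ad}^*_\xi\mu,\eta\rangle=\langle\mu,[\xi,\eta]\rangle$. $T^*G$ is identified with $G\times\mathfrak g^*$ by $\alpha_g\mapsto(g,T_e^*R_g\alpha_g)$. $TT^*G=T(G\times\mathfrak g^* )$ is identified with $G\times\mathfrak g_1^*\times\mathfrak g_2\times\mathfrak g_3^*$ by sending $(V_g,V_\mu)$ at $(g,\mu)$ to $(g,\mu,\xi,\nu)$, $\xi=T_gR_{g^{-1}}V_g$, $\nu=V_\mu-\mathrm{ad}^*_\xi\mu$. The Tulczyjew symplectic form $\Omega_{TT^*G}$ is the tangent (complete) lift of the canonical form $d\theta$ of $T^*G$ ($\theta$ the Liouville form), transported by this map: on vectors $(T_eR_ga,\delta\mu,\delta\xi,\delta\nu)$, $(T_eR_g\bar a,\delta\bar\mu,\delta\bar\xi,\delta\bar\nu)$ at $(g,\mu,\xi,\nu)$ it equals $\langle\delta\nu,\bar a\rangle-\langle\delta\bar\nu,a\rangle-\langle\nu,[a,\bar a]\rangle+\langle\delta\mu,\delta\bar\xi\rangle-\langle\delta\bar\mu,\delta\xi\rangle$.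 Hamiltonian vector fields satisfy $i_{X_E}\Omega=-dE$; the Poisson bracket is $\{E,F\}=dF(X_E)$; the reduced bracket is its restriction to $G$-invariant functions, i.e. $E=E(\mu,\xi,\nu)$, $F=F(\mu,\xi,\nu)$. $\frac{\delta E}{\delta\mu},\frac{\delta E}{\delta\nu}\in\mathfrak g$, $\frac{\delta E}{\delta\xi}\in\mathfrak g^*$ are partial derivatives. *)

(* Defs.v *)
From HB Require Import structures.
From mathcomp Require Import all_boot all_order all_algebra.
From mathcomp Require Import all_classical all_reals all_analysis.

Set Implicit Arguments.
Unset Strict Implicit.
Unset Printing Implicit Defensive.

Import Order.TTheory GRing.Theory Num.Theory.
Import numFieldNormedType.Exports.

Local Open Scope classical_set_scope.
Local Open Scope ring_scope.

Definition dderiv (R : realType) (E F : normedModType R)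
    (f : E -> F) (vs : seq E) : E -> F :=
  foldr (fun v g => 'D_v g) f vs.

(* C^infinity on a neighbourhood of [x]: every iterated directional derivative
   exists and is differentiable there.  For finite-dimensional [E] this is the
   usual notion. *)
Definition smooth_at (R : realType) (E F : normedModType R)
    (x : E) (f : E -> F) : Prop :=
  \forall y \near x, forall vs, differentiable (dderiv f vs) y.

(* A manifold without boundary modelled on [E].  The atlas is indexed by the
   points: [chart p] is a distinguished chart around [p], defined on the open set [cdom p], with inverse [unchart p];
   outside [cdom p], resp. its image, these total functions are junk.
   Separation and countability conditions are imposed in [lieGroup] only. *)
Record manifold (R : realType) (E : normedModType R) := Manifold {
  mpoint :> topologicalType;
  cdom : mpoint -> set mpoint;
  chart : mpoint -> mpoint -> E;
  unchart : mpoint -> E -> mpoint;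
  cdom_open : forall p, open (cdom p);
  mem_cdom : forall p, cdom p p;
  chartK : forall p q, cdom p q -> unchart p (chart p q) = q;
  cimg_open : forall p, open (chart p @` cdom p);
  chart_continuous : forall p q, cdom p q -> {for q, continuous (chart p)};
  unchart_continuous : forall p x, (chart p @` cdom p) x ->
    {for x, continuous (unchart p)};
  chart_smooth : forall p q x, (chart p @` (cdom p `&` cdom q)) x ->
    smooth_at x (chart q \o unchart p)
}.

Section Smooth.
Context (R : realType).

Lemma near_eq_differentiable (E F : normedModType R) (f g : E -> F) x :
  (\near x, f x = g x) -> differentiable f x -> differentiable g x.
Proof.
move=> fg df.
have cdf : continuous ('d f x) by exact: diff_continuous.
have Hg : g \o shift x = cst (g x) + 'd f x +o_ 0 id.
  apply/eqaddoP => e e0.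
  have fgx : f x = g x by exact: (nbhs_singleton fg).
  have fg0 : \forall h \near (0 : E), f (h + x) = g (h + x).
    move: fg; rewrite (near_shift 0 x).
    by apply: filterS => h /=; rewrite subr0.
  have := diff_locally df; move/eqaddoP => /(_ e e0).
  apply: filterS2 fg0 => h fgh.
  by rewrite !fctE /= fgh fgx.
have dgE := diff_unique cdf Hg.
by apply/diff_locallyP; rewrite dgE.
Qed.

Lemma near_smooth_at (E F : normedModType R) (f : E -> F) x :
  smooth_at x f -> \forall y \near x, smooth_at y f.
Proof. by move=> fx; rewrite /smooth_at; exact: near_join. Qed.

Lemma smooth_at_diff (E F : normedModType R) (f : E -> F) x vs :
  smooth_at x f -> differentiable (dderiv f vs) x.
Proof. by move=> /nbhs_singleton. Qed.

Lemma near_prod1 (E1 E2 : normedModType R) (P : E1 -> Prop) (Q : E2 -> Prop)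
    (z : E1 * E2) :
  (\forall x \near z.1, P x) -> (\forall y \near z.2, Q y) ->
  \forall w \near z, P w.1 /\ Q w.2.
Proof. by move=> Pz Qz; exists (P, Q). Qed.

Definition prod_fun (E1 E2 F1 F2 : Type) (f : E1 -> F1) (g : E2 -> F2)
  (z : E1 * E2) : F1 * F2 := (f z.1, g z.2).

Lemma diff_prod_fun (E1 E2 F1 F2 : normedModType R) (f : E1 -> F1)
    (g : E2 -> F2) (z : E1 * E2) :
  differentiable f z.1 -> differentiable g z.2 ->
  differentiable (prod_fun f g) z /\
  forall v, 'd (prod_fun f g) z v = ('d f (z.1) v.1, 'd g (z.2) v.2).
Proof.
move=> df dg.
have fst_lin : linear (fst : E1 * E2 -> E1) by move=> a [] ? ? [].
have snd_lin : linear (snd : E1 * E2 -> E2) by move=> a [] ? ? [].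
pose pfst : {linear (E1 * E2)%type -> E1} :=
  HB.pack (fst : E1 * E2 -> E1) (GRing.isLinear.Build _ _ _ _ _ fst_lin).
pose psnd : {linear (E1 * E2)%type -> E2} :=
  HB.pack (snd : E1 * E2 -> E2) (GRing.isLinear.Build _ _ _ _ _ snd_lin).
have cf : continuous (pfst : E1 * E2 -> E1) by move=> y; exact: cvg_fst.
have cs : continuous (psnd : E1 * E2 -> E2) by move=> y; exact: cvg_snd.
have d1 : differentiable (pfst : E1 * E2 -> E1) z.
  exact: linear_differentiable.
have d2 : differentiable (psnd : E1 * E2 -> E2) z.
  exact: linear_differentiable.
have h1 : differentiable (f \o pfst) z by exact: differentiable_comp.
have h2 : differentiable (g \o psnd) z by exact: differentiable_comp.
split; first exact: (differentiable_pair h1 h2).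
move=> v.
have -> : 'd (prod_fun f g) z v = ('d (f \o pfst) z v, 'd (g \o psnd) z v).
  exact: (congr1 (fun k => k v) (diff_pair h1 h2)).
have -> : 'd (f \o pfst) z v = 'd f (z.1) ('d (pfst : E1 * E2 -> E1) z v).
  exact: (congr1 (fun k => k v) (diff_comp d1 df)).
have -> : 'd (g \o psnd) z v = 'd g (z.2) ('d (psnd : E1 * E2 -> E2) z v).
  exact: (congr1 (fun k => k v) (diff_comp d2 dg)).
have -> : 'd (pfst : E1 * E2 -> E1) z v = v.1.
  exact: (congr1 (fun k => k v) (diff_lin z cf)).
have -> // : 'd (psnd : E1 * E2 -> E2) z v = v.2.
exact: (congr1 (fun k => k v) (diff_lin z cs)).
Qed.

Lemma dderiv_prod_fun (E1 E2 F1 F2 : normedModType R) (f : E1 -> F1)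
    (g : E2 -> F2) vs (z : E1 * E2) :
  smooth_at z.1 f -> smooth_at z.2 g ->
  dderiv (prod_fun f g) vs z =
  prod_fun (dderiv f (map fst vs)) (dderiv g (map snd vs)) z.
Proof.
elim: vs z => [|v vs IH] z fz gz //=.
have fg := near_prod1 (near_smooth_at fz) (near_smooth_at gz).
rewrite (@near_eq_derive _ _ _ _
  (prod_fun (dderiv f (map fst vs)) (dderiv g (map snd vs)))); last first.
  by apply: filterS fg => w [fw gw]; exact: IH.
have [df dfE] := diff_prod_fun (smooth_at_diff (map fst vs) fz)
  (smooth_at_diff (map snd vs) gz).
rewrite deriveE // dfE /prod_fun /= !deriveE //; exact: smooth_at_diff.
Qed.

Lemma smooth_at_prod_fun (E1 E2 F1 F2 : normedModType R) (f : E1 -> F1)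
    (g : E2 -> F2) (z : E1 * E2) :
  smooth_at z.1 f -> smooth_at z.2 g -> smooth_at z (prod_fun f g).
Proof.
move=> fz gz.
have fg := near_prod1 (near_smooth_at fz) (near_smooth_at gz).
rewrite /smooth_at; apply: filterS (near_join fg) => w fgw vs.
have [fw gw] := nbhs_singleton fgw.
apply: near_eq_differentiable; last first.
  by apply: (diff_prod_fun _ _).1;
    [exact: (smooth_at_diff (map fst vs) fw)|
     exact: (smooth_at_diff (map snd vs) gw)].
by apply: filterS fgw => y [fy gy]; rewrite dderiv_prod_fun.
Qed.

Lemma smooth_at_id (E : normedModType R) (x : E) : smooth_at x idfun.
Proof.
have cstS (c : E) vs : exists c', dderiv (cst c : E -> E) vs = cst c'.
  elim: vs => [|v vs [c' IH]]; first by exists c.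
  by exists 0; apply/funext => y; rewrite /= IH derive_cst.
have dS vs y : differentiable (dderiv (idfun : E -> E) vs) y.
  have [->|[c ->]] : dderiv (idfun : E -> E) vs = idfun \/
      exists c, dderiv (idfun : E -> E) vs = cst c.
  - elim: vs => [|v vs IH]; first by left.
    right; case: IH => [IH|[c IH]] /=; rewrite IH.
      by exists v; apply/funext => y'; rewrite derive_id.
    by exists 0; apply/funext => y'; rewrite derive_cst.
  - exact: (@ex_diff _ _ _ _ _ _ _ (is_diff_id y)).
  - exact: differentiable_cst.
by apply: nearW => y vs; exact: dS.
Qed.

End Smooth.

Section Prod.
Context (R : realType) (E F : normedModType R) (M : manifold E)
  (N : manifold F).

Let dom (p : M * N) : set (M * N) := cdom p.1 `*` cdom p.2.
Let ch (p : M * N) : M * N -> E * F := prod_fun (chart p.1) (chart p.2).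
Let uch (p : M * N) : E * F -> M * N := prod_fun (unchart p.1) (unchart p.2).

Let ch_img p (A : set M) (B : set N) :
  ch p @` (A `*` B) = (chart p.1 @` A) `*` (chart p.2 @` B).
Proof.
apply/seteqP; split=> [_ [[a b] [/= Aa Bb] <-]|[x y] [/= [a Aa <-] [b Bb <-]]].
  by split=> /=; [exists a|exists b].
by exists (a, b).
Qed.

Let open_setX (T U : topologicalType) (A : set T) (B : set U) :
  open A -> open B -> open (A `*` B).
Proof.
rewrite !openE => oA oB [x y] [/= Ax By].
by exists (A, B) => //; split; [exact: oA|exact: oB].
Qed.

Let dom_open p : open (dom p).
Proof. exact: open_setX (@cdom_open _ _ _ _) (@cdom_open _ _ _ _). Qed.

Let mem_dom p : dom p p.
Proof. by split; exact: mem_cdom. Qed.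

Let chK p q : dom p q -> uch p (ch p q) = q.
Proof.
by case: q => a b [/= ha hb]; rewrite /uch /ch /prod_fun /= !chartK.
Qed.

Let img_open p : open (ch p @` dom p).
Proof.
by rewrite /dom ch_img; exact: open_setX (@cimg_open _ _ _ _) (@cimg_open _ _ _ _).
Qed.

Let prod_fun_continuous (T1 T2 U1 U2 : topologicalType) (f : T1 -> U1)
    (g : T2 -> U2) (z : T1 * T2) :
  {for z.1, continuous f} -> {for z.2, continuous g} ->
  {for z, continuous (prod_fun f g)}.
Proof.
move=> cf cg; apply: cvg_pair.
  by apply: (cvg_comp fst f); [exact: cvg_fst|exact: cf].
by apply: (cvg_comp snd g); [exact: cvg_snd|exact: cg].
Qed.

Let ch_cont p q : dom p q -> {for q, continuous (ch p)}.
Proof. by move=> [? ?]; apply: prod_fun_continuous; exact: chart_continuous. Qed.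

Let uch_cont p x : (ch p @` dom p) x -> {for x, continuous (uch p)}.
Proof.
rewrite /dom ch_img => -[? ?].
by apply: prod_fun_continuous; exact: unchart_continuous.
Qed.

Let ch_smooth p q x : (ch p @` (dom p `&` dom q)) x ->
  smooth_at x (ch q \o uch p).
Proof.
rewrite /dom -setXI ch_img => -[h1 h2].
exact: (smooth_at_prod_fun (chart_smooth h1) (chart_smooth h2)).
Qed.

Definition prod_mfd : manifold (E * F)%type :=
  @Manifold R (E * F)%type (M * N)%type dom ch uch dom_open mem_dom chK
    img_open ch_cont uch_cont ch_smooth.

End Prod.

Section Space.
Context (R : realType) (E : normedModType R).

Let idT_img : [set x : E | True] = (idfun : E -> E) @` setT.
Proof. by apply/seteqP; split=> // x _; exists x. Qed.

Let id_open (p : E) : open ((idfun : E -> E) @` setT).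
Proof. by rewrite -idT_img; exact: openT. Qed.

Definition space_mfd : manifold E :=
  @Manifold R E E (fun=> setT) (fun=> idfun) (fun=> idfun)
    (fun=> openT) (fun=> I) (fun _ _ _ => erefl) id_open
    (fun _ _ _ => @cvg_id _ _) (fun _ _ _ => @cvg_id _ _)
    (fun _ _ x _ => smooth_at_id x).

End Space.
Arguments space_mfd {R} E.

Section Calculus.
Context (R : realType).

(* The tangent space at [p] is represented by the model space [E]: a tangent
   vector is given by its components in the chart [chart p].  A vector field is
   a function [M -> E] whose value at [p] is read in [chart p]. *)
Definition tangent (E : normedModType R) (M : manifold E) (p : M) : Type := E.

Definition local_rep (E F : normedModType R) (M : manifold E) (N : manifold F)
    (f : M -> N) (p : M) : E -> F :=
  chart (f p) \o f \o unchart p.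

Definition smooth_map (E F : normedModType R) (M : manifold E)
    (N : manifold F) (f : M -> N) : Prop :=
  continuous f /\ forall p, smooth_at (chart p p) (local_rep f p).

Definition tmap (E F : normedModType R) (M : manifold E) (N : manifold F)
    (f : M -> N) (p : M) (v : tangent p) : tangent (f p) :=
  'd (local_rep f p) (chart p p) v.

Definition smooth_fun (E : normedModType R) (M : manifold E) (f : M -> R) :=
  smooth_map (f : M -> space_mfd R).

Definition dfun (E : normedModType R) (M : manifold E) (f : M -> R) (p : M)
    (v : tangent p) : R :=
  tmap (f : M -> space_mfd R) v.

Definition vector_field (E : normedModType R) (M : manifold E) :=
  forall p : M, tangent p.

(* Components, in the fixed chart around [p], of the vector field [X]. *)
Definition vf_in_chart (E : normedModType R) (M : manifold E)
    (X : vector_field M) (p : M) (x : E) : E :=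
  let q := unchart p x in 'd (chart p \o unchart q) (chart q q) (X q).

(* In coordinates [X,Y]^i = X^j d_j Y^i - Y^j d_j X^i, i.e. the commutator of
   derivations [X, Y] = XY - YX. *)
Definition jacobi_lie (E : normedModType R) (M : manifold E)
    (X Y : vector_field M) : vector_field M := fun p =>
  let x := chart p p in
  'd (vf_in_chart Y p) x (vf_in_chart X p x)
  - 'd (vf_in_chart X p) x (vf_in_chart Y p x).

End Calculus.
Arguments tmap {R E F M N} f p v.
Arguments dfun {R E M} f p v.

Record lieGroup (R : realType) (n : nat) := LieGroup {
  lie_mfd :> manifold 'rV[R]_n;
  lie_hausdorff : hausdorff_space lie_mfd;
  lie_second_countable : @second_countable lie_mfd;
  lmul : lie_mfd -> lie_mfd -> lie_mfd;
  lone : lie_mfd;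
  linv : lie_mfd -> lie_mfd;
  lmulA : associative lmul;
  lmul1g : left_id lone lmul;
  lmulVg : left_inverse lone linv lmul;
  lmul_smooth : smooth_map (M := prod_mfd lie_mfd lie_mfd) (N := lie_mfd)
    (fun p => lmul p.1 p.2);
  linv_smooth : smooth_map linv
}.
Arguments lone {R n l}.

Section LieAlgebra.
Context (R : realType) (n : nat) (G : lieGroup R n).

(* [g = T_e G] in the coordinates given by [chart e], and the coordinates of
   the dual basis on [g^*]. *)
Definition lieAlg : normedModType R := 'rV[R]_n.
Definition lieDual : normedModType R := 'cV[R]_n.

Definition pairing (mu : lieDual) (xi : lieAlg) : R := (xi *m mu) 0 0.

Definition rtrans (h : G) : G -> G := fun g => lmul g h.

Definition rinv_field (xi : lieAlg) : vector_field G :=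
  fun g => tmap (rtrans g) lone xi.

(* [[X_xi, X_eta] = X_[xi, eta]] evaluated at [e]: opposite to the bracket of
   left invariant vector fields. *)
Definition lie_bracket (xi eta : lieAlg) : lieAlg :=
  jacobi_lie (rinv_field xi) (rinv_field eta) lone.

(* [T_g R_{g^{-1}} : T_g G -> g]. *)
Definition rtriv (g : G) (v : tangent g) : lieAlg :=
  tmap (rtrans (linv g)) g v.

End LieAlgebra.
Arguments lieAlg : clear implicits.
Arguments lieDual : clear implicits.
Arguments lie_bracket {R n} G xi eta.
Arguments rtriv {R n} G g v.

Section Poisson.
Context (R : realType).

Definition two_form (E : normedModType R) (M : manifold E) :=
  forall p : M, tangent p -> tangent p -> R.

Definition hamiltonian_field (E : normedModType R) (M : manifold E)
    (Omega : two_form M) (H : M -> R) (X : vector_field M) : Prop :=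
  forall p (v : tangent p), Omega p (X p) v = - dfun H p v.

(* The Hamiltonian vector field of [H]; it is 0 where [i_X Omega = - dH] has no
   solution. *)
Definition ham (E : normedModType R) (M : manifold E) (Omega : two_form M)
    (H : M -> R) : vector_field M := fun p =>
  xget (0 : E) [set X : E | forall v : E, Omega p X v = - dfun H p v].

Definition symplectic_bracket (E : normedModType R) (M : manifold E)
    (Omega : two_form M) (H K : M -> R) : M -> R :=
  fun p => dfun K p (ham Omega H p).

Record poisson_bracket (E : normedModType R) (M : manifold E)
    (br : (M -> R) -> (M -> R) -> M -> R) : Prop := {
  pb_smooth : forall H K, smooth_fun H -> smooth_fun K -> smooth_fun (br H K);
  pb_linear : forall a H H' K, smooth_fun H -> smooth_fun H' -> smooth_fun K ->
    br (fun p => a * H p + H' p) K = (fun p => a * br H K p + br H' K p);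
  pb_antisym : forall H K, smooth_fun H -> smooth_fun K ->
    br H K = (fun p => - br K H p);
  pb_leibniz : forall H K K', smooth_fun H -> smooth_fun K -> smooth_fun K' ->
    br H (fun p => K p * K' p) =
    (fun p => br H K p * K' p + K p * br H K' p);
  pb_jacobi : forall H K J, smooth_fun H -> smooth_fun K -> smooth_fun J ->
    forall p, br H (br K J) p + br K (br J H) p + br J (br H K) p = 0
}.

Record right_action (n : nat) (G : lieGroup R n) (E : normedModType R)
    (M : manifold E) (act : M -> G -> M) : Prop := {
  act_smooth : smooth_map (M := prod_mfd M G) (fun z => act z.1 z.2);
  act1 : forall p, act p lone = p;
  actM : forall p g h, act (act p g) h = act p (lmul g h)
}.

(* [N] with [brN] is, through [pi], the Poisson reduction of [M] with [brM]
   under [act]: [pi] presents [N] as the smooth orbit space, and [brN] is the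
   restriction of [brM] to the invariant functions, identified with the
   functions on [N]. *)
Record poisson_reduction (n : nat) (G : lieGroup R n) (E F : normedModType R)
    (M : manifold E) (brM : (M -> R) -> (M -> R) -> M -> R)
    (act : M -> G -> M) (N : manifold F) (pi : M -> N)
    (brN : (N -> R) -> (N -> R) -> N -> R) : Prop := {
  red_action : right_action act;
  red_canonical : forall g H K, smooth_fun H -> smooth_fun K ->
    brM (H \o act^~ g) (K \o act^~ g) = brM H K \o act^~ g;
  red_smooth : smooth_map pi;
  red_surj : forall q, exists p, pi p = q;
  red_submersion : forall p (w : tangent (pi p)), exists v, tmap pi p v = w;
  red_orbits : forall p p', pi p = pi p' <-> exists g, p' = act p g;
  red_invariant : forall H : M -> R,
    smooth_fun H /\ (forall p g, H (act p g) = H p) <->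
    exists2 h : N -> R, smooth_fun h & H = h \o pi;
  red_poisson : poisson_bracket brN;
  red_bracket : forall h k, smooth_fun h -> smooth_fun k ->
    brM (h \o pi) (k \o pi) = brN h k \o pi
}.

End Poisson.

Section TTstar.
Context (R : realType) (n : nat) (G : lieGroup R n).

(* [g_1^* x (g_2 x g_3^* )], with points [(mu, (xi, nu))]. *)
Definition redSpace : normedModType R :=
  (lieDual R n * (lieAlg R n * lieDual R n))%type.

(* [TT^*G] in the right trivialization, with points [(g, (mu, (xi, nu)))]:
   [alpha_g] in [T^*G] is [(g, mu)] with [mu = T_e^*R_g alpha_g], and a tangent
   vector [(V_g, V_mu)] there is given by [xi = T_g R_{g^{-1}} V_g] and
   [nu = V_mu - ad^*_xi mu]. *)
Definition TTstar := prod_mfd G (space_mfd redSpace).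

(* The tangent lift of the canonical symplectic form [d theta] of [T^*G], in
   this trivialization; vectors tangent to the factor [G] are right translated
   to the Lie algebra, those tangent to the linear factors are left as they
   are. *)
Definition tulczyjew : two_form TTstar := fun p v w =>
  let: (g, (_, (_, nu))) := p in
  let: (vg, (dmu, (dxi, dnu))) := v in
  let: (wg, (dmu', (dxi', dnu'))) := w in
  let a := rtriv G g vg in
  let a' := rtriv G g wg in
  pairing dnu a' - pairing dnu' a - pairing nu (lie_bracket G a a')
  + pairing dmu dxi' - pairing dmu' dxi.

Definition TTstar_act (p : TTstar) (h : G) : TTstar := (lmul p.1 h, p.2).

Definition TTstar_proj (p : TTstar) : space_mfd redSpace := p.2.

(* The partial derivatives: delta E / delta mu and delta E / delta nu are in
   the bidual [g^** = g], delta E / delta xi is in [g^*]. *)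
Definition d_mu (E : redSpace -> R) (w : redSpace) : lieAlg R n :=
  \row_i 'D_((delta_mx i 0, (0, 0)) : redSpace) E w.
Definition d_xi (E : redSpace -> R) (w : redSpace) : lieDual R n :=
  \col_i 'D_((0, (delta_mx 0 i, 0)) : redSpace) E w.
Definition d_nu (E : redSpace -> R) (w : redSpace) : lieAlg R n :=
  \row_i 'D_((0, (0, delta_mx i 0)) : redSpace) E w.

Definition reduced_bracket (E F : redSpace -> R) (w : redSpace) : R :=
  pairing (d_xi F w) (d_mu E w) - pairing (d_xi E w) (d_mu F w)
  + pairing w.2.2 (lie_bracket G (d_nu E w) (d_nu F w)).

End TTstar.

(* Main.v *)
(* Right translation to the identity trivializes the first factor of a tangent
   vector, and in this trivialization the Tulczyjew form is visibly
   nondegenerate: the Hamiltonian vector field of an invariant function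
   [h (mu, xi, nu)] is [(dh/dnu, (- dh/dxi, (dh/dmu, ad^*_(dh/dnu) nu)))], which
   gives the reduced bracket.

   The Jacobi identity of the reduced bracket comes from two facts.  By the
   symmetry of second derivatives its Jacobiator is a derivation in each
   argument, so it may be computed on linear functions, where it is the pairing
   of [nu] with the Jacobiator of the Lie bracket.  For the latter, let [m] be
   the group law in the chart at the identity and let [B] be its mixed second
   derivative there.  The Lie bracket is the commutator of [B], and the third
   order part of the associativity of [m] writes the associator of [B] as the
   sum of a term symmetric in its first two arguments and a term symmetric in
   its last two, so that the alternating sum of the associators vanishes. *)
Require Import Defs.
From HB Require Import structures.
From mathcomp Require Import all_boot all_order all_algebra.
From mathcomp Require Import all_classical all_reals all_analysis.
From mathcomp Require Import ring lra.

Set Implicit Arguments.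
Unset Strict Implicit.
Unset Printing Implicit Defensive.

Import Order.TTheory GRing.Theory Num.Theory.
Import numFieldNormedType.Exports.

Local Open Scope classical_set_scope.
Local Open Scope ring_scope.

(** * Smooth functions *)

Section Calculus.
Context (R : realType).
Implicit Types E F W : normedModType R.

Lemma is_diff_linear E F (f : E -> F) x :
  linear f -> continuous f -> is_diff x f f.
Proof.
move=> lf cf.
pose g : {linear E -> F} := HB.pack f (GRing.isLinear.Build _ _ _ _ _ lf).
by apply: DiffDef; [exact: (@linear_differentiable _ _ _ g)
                   |exact: (@diff_lin _ _ _ g)].
Qed.

(** The differential depends on the germ only. Two expressions of one germ, each with its
    differential, thus give an identity between derivatives; this is how the group axioms are
    differentiated below. *)
Lemma is_diff_near_eq E F (f g df : E -> F) (x : E) :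
  (\forall y \near x, f y = g y) -> is_diff x f df -> is_diff x g df.
Proof.
move=> fg [dfx dfE].
have dg := near_eq_differentiable fg dfx.
apply: DiffDef => //; apply/funext => v.
by rewrite -deriveE // -(near_eq_derive v fg) deriveE // dfE.
Qed.

Lemma is_diff_derive E F (f df : E -> F) x v :
  is_diff x f df -> 'D_v f x = df v.
Proof. by move=> [dfx dfE]; rewrite deriveE // dfE. Qed.

Lemma is_diff_Ediff E F (f df : E -> F) x v : is_diff x f df -> 'd f x v = df v.
Proof. by move=> [dfx dfE]; rewrite dfE. Qed.

Lemma derive_lin E F (f : E -> F) x : differentiable f x ->
  linear (fun v => 'D_v f x).
Proof. by move=> df a u v; rewrite !deriveE // linearP. Qed.

Lemma scaler_bilinear E : bilinear_for
    (GRing.Scale.Law.clone _ _ *:%R _) (GRing.Scale.Law.clone _ _ *:%R _)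
    (fun (a : R^o) (v : E) => a *: v).
Proof.
split=> [u'|u] a x y /=; first by rewrite scalerDl scalerA.
by rewrite scalerDr !scalerA mulrC.
Qed.

Lemma is_diff_scale E F (k dk : E -> R) (f df : E -> F) x :
  is_diff x k dk -> is_diff x f df ->
  is_diff x (fun y => k y *: f y) (fun h => k x *: df h + dk h *: f x).
Proof.
move=> dkx dfx.
pose b : {bilinear R^o -> F -> F} := HB.pack (fun (a : R^o) (v : F) => a *: v)
  (bilinear_isBilinear.Build R R^o F F _ _ _ (scaler_bilinear F)).
have bc : continuous (fun p : R^o * F => b p.1 p.2) by exact: scale_continuous.
have db p : is_diff p (fun q : R^o * F => q.1 *: q.2)
    (fun q : R^o * F => p.1 *: q.2 + q.1 *: p.2).
  by apply: DiffDef; [exact: (differentiable_bilin p bc)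
                     |exact: (diff_bilin p bc)].
have -> : (fun y => k y *: f y) = (fun q : R^o * F => q.1 *: q.2) \o
  (fun y => (k y, f y)) by [].
by apply: is_diff_eq.
Qed.

Lemma dderiv_rcons E F (f : E -> F) vs v :
  dderiv f (rcons vs v) = dderiv ('D_v f) vs.
Proof. by rewrite /dderiv foldr_rcons. Qed.

Lemma smooth_at_derive E F (f : E -> F) x v :
  smooth_at x f -> smooth_at x ('D_v f).
Proof.
by apply: filterS => y + vs => /(_ (rcons vs v)); rewrite dderiv_rcons.
Qed.

Lemma smooth_at_differentiable E F (f : E -> F) x :
  smooth_at x f -> differentiable f x.
Proof. exact: (@smooth_at_diff _ _ _ _ _ [::]). Qed.

Lemma near_eq_dderiv E F (f g : E -> F) (x : E) vs :
  (\forall y \near x, f y = g y) ->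
  \forall y \near x, dderiv f vs y = dderiv g vs y.
Proof.
move=> fg; elim: vs => [//|v vs IH] /=.
by apply: filterS (near_join IH) => y; exact: near_eq_derive.
Qed.

Lemma near_eq_smooth_at E F (f g : E -> F) (x : E) :
  (\forall y \near x, f y = g y) -> smooth_at x f -> smooth_at x g.
Proof.
move=> /near_join fg fx; rewrite /smooth_at.
apply: filterS2 fg fx => y fgy fy vs.
exact: near_eq_differentiable (near_eq_dderiv vs fgy) (fy vs).
Qed.

(** A constant differential [L] keeps the chain rule simple at every order: deriving [f \o u] along
    [vs] amounts to deriving [f] along the images of [vs] under [L]. *)
Lemma smooth_at_comp_affine E F W (f : E -> F) (u L : W -> E) x :
  (forall y, is_diff y u L) -> smooth_at (u x) f -> smooth_at x (f \o u).
Proof.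
move=> uL.
have cu y : {for y, continuous u} by apply: differentiable_continuous.
have nearu (P : set E) y : (\forall z \near u y, P z) ->
    \forall z \near y, P (u z) by apply: cu.
have key vs y : smooth_at (u y) f ->
    dderiv (f \o u) vs y = dderiv f (map L vs) (u y).
  elim: vs y => [//|v vs IH] y fy /=.
  rewrite (@near_eq_derive _ _ _ _ (dderiv f (map L vs) \o u)); last first.
    have := nearu _ _ (near_smooth_at fy).
    by apply: filterS => z; exact: IH.
  have df := smooth_at_diff (map L vs) fy.
  rewrite deriveE; last exact: differentiable_comp.
  by rewrite diff_comp //= (is_diff_Ediff _ (uL y)) deriveE.
move=> fx; rewrite /smooth_at.
apply: filterS (near_join (nearu _ _ (near_smooth_at fx))) => y fy vs.
apply: near_eq_differentiable.
  by apply: filterS fy => z fz; exact/esym/key.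
apply: differentiable_comp => //; apply: smooth_at_diff.
exact: nbhs_singleton fy.
Qed.

(* The directional derivative of a polynomial expression in smooth functions
   is again such an expression, so that smoothness of all of them follows from
   mere differentiability. *)
Inductive smooth_expr E (U : set E) : (E -> R) -> Prop :=
| SmoothAtom f : (forall y, U y -> smooth_at y f) -> smooth_expr U f
| SmoothAdd f g : smooth_expr U f -> smooth_expr U g ->
    smooth_expr U (fun x => f x + g x)
| SmoothMul f g : smooth_expr U f -> smooth_expr U g ->
    smooth_expr U (fun x => f x * g x).

Lemma smooth_expr_differentiable E (U : set E) f y :
  smooth_expr U f -> U y -> differentiable f y.
Proof.
elim=> {f} [f fU|f g _ IHf _ IHg|f g _ IHf _ IHg] Uy.
- exact: smooth_at_differentiable (fU _ Uy).
- exact: differentiableD (IHf Uy) (IHg Uy).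
- exact: differentiableM (IHf Uy) (IHg Uy).
Qed.

Lemma smooth_expr_derive E (U : set E) f v : smooth_expr U f ->
  exists2 g, smooth_expr U g & forall y, U y -> 'D_v f y = g y.
Proof.
elim=> {f} [f fU|f g sf [f' sf' ff'] sg [g' sg' gg']
           |f g sf [f' sf' ff'] sg [g' sg' gg']].
- exists ('D_v f) => //; apply: SmoothAtom => y Uy.
  exact: smooth_at_derive (fU _ Uy).
- exists (fun x => f' x + g' x); first exact: SmoothAdd.
  move=> y Uy; rewrite -ff' // -gg' //.
  by apply: deriveD; apply: diff_derivable;
    apply: smooth_expr_differentiable Uy.
- exists (fun x => f x * g' x + g x * f' x).
    by apply: SmoothAdd; apply: SmoothMul.
  move=> y Uy; rewrite -ff' // -gg' //.
  by apply: deriveM; apply: diff_derivable;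
    apply: smooth_expr_differentiable Uy.
Qed.

Lemma smooth_expr_smooth_at E (U : set E) f x :
  open U -> U x -> smooth_expr U f -> smooth_at x f.
Proof.
move=> oU Ux sf.
have nearU y : U y -> \forall z \near y, U z.
  by move=> Uy; apply: open_nbhs_nbhs; split.
(* [U] is open, so agreement on [U] with an expression is agreement of germs and survives the next
   derivative. *)
have key vs : exists2 g, smooth_expr U g & forall y, U y -> dderiv f vs y = g y.
  elim: vs => [|v vs [g sg fg]]; first by exists f.
  have [g' sg' gg'] := smooth_expr_derive v sg.
  exists g' => // y Uy /=; rewrite -gg' //; apply: near_eq_derive.
  by apply: filterS (nearU _ Uy) => z; exact: fg.
apply: filterS (nearU _ Ux) => y Uy vs; have [g sg fg] := key vs.
apply: near_eq_differentiable (smooth_expr_differentiable sg Uy).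
by apply: filterS (nearU _ Uy) => z Uz; rewrite fg.
Qed.

Lemma smooth_at_cst E F (c : F) (x : E) : smooth_at x (cst c).
Proof.
apply: nearW => y vs.
have [c' ->] : exists c', dderiv (cst c : E -> F) vs = cst c'.
  elim: vs => [|v vs [c' IH]]; first by exists c.
  by exists 0; apply/funext => z /=; rewrite IH derive_cst.
exact: differentiable_cst.
Qed.

(** Smoothness is an open condition, so [f] and [g] become atoms over one common open set. *)
Let smooth2 E (f g : E -> R) x : smooth_at x f -> smooth_at x g ->
  exists U : set E, [/\ open U, U x, smooth_expr U f & smooth_expr U g].
Proof.
move=> /near_smooth_at fx /near_smooth_at gx.
have : nbhs x [set y | smooth_at y f /\ smooth_at y g] by exact: filterI.
rewrite nbhsE => -[U [oU Ux] UV].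
by exists U; split => //; apply: SmoothAtom => y /UV [].
Qed.

Lemma smooth_atD E (f g : E -> R) x :
  smooth_at x f -> smooth_at x g -> smooth_at x (fun y => f y + g y).
Proof.
move=> fx gx; have [U [oU Ux fU gU]] := smooth2 fx gx.
exact: smooth_expr_smooth_at oU Ux (SmoothAdd fU gU).
Qed.

Lemma smooth_atM E (f g : E -> R) x :
  smooth_at x f -> smooth_at x g -> smooth_at x (fun y => f y * g y).
Proof.
move=> fx gx; have [U [oU Ux fU gU]] := smooth2 fx gx.
exact: smooth_expr_smooth_at oU Ux (SmoothMul fU gU).
Qed.

Lemma smooth_atN E (f : E -> R) x :
  smooth_at x f -> smooth_at x (fun y => - f y).
Proof.
move=> fx; have := smooth_atM (smooth_at_cst (-1 : R) x) fx.
by apply: near_eq_smooth_at; apply: nearW => y; rewrite mulN1r.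
Qed.

Lemma smooth_at_sum E (I : finType) (f : I -> E -> R) x :
  (forall i, smooth_at x (f i)) -> smooth_at x (fun y => \sum_i f i y).
Proof.
move=> fx; elim: (index_enum I) => [|i s IH].
  apply: near_eq_smooth_at (smooth_at_cst (0 : R) x).
  by apply: nearW => y; rewrite big_nil.
apply: near_eq_smooth_at (smooth_atD (fx i) IH).
by apply: nearW => y; rewrite big_cons.
Qed.

Lemma smooth_at_linear E (f : E -> R) x :
  linear f -> continuous f -> smooth_at x f.
Proof.
move=> lf cf.
have := @smooth_at_comp_affine _ _ _ idfun f f x
  (fun y => is_diff_linear y lf cf) (smooth_at_id _).
exact.
Qed.

End Calculus.

(** * Second derivatives *)

Section SecondOrder.
Context (R : realType).
Implicit Types E F W : normedModType R.

Lemma is_diffD_fun E F (f g df dg : E -> F) x :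
  is_diff x f df -> is_diff x g dg ->
  is_diff x (fun y => f y + g y) (fun h => df h + dg h).
Proof. exact: is_diffD. Qed.

Lemma is_diff_deriveP E F (f : E -> F) x :
  differentiable f x -> is_diff x f (fun h => 'D_h f x).
Proof.
by move=> df; apply: DiffDef => //; apply/funext => h; rewrite deriveE.
Qed.

Lemma eq_is_diff E F (f g df : E -> F) x :
  f =1 g -> is_diff x f df -> is_diff x g df.
Proof. by move=> /funext ->. Qed.

Lemma is_diff_sum E F (I : finType) (f df : I -> E -> F) x :
  (forall i, is_diff x (f i) (df i)) ->
  is_diff x (fun y => \sum_i f i y) (fun h => \sum_i df i h).
Proof.
move=> fx; elim: (index_enum I) => [|i s IH].
  have -> : (fun y => \sum_(i <- [::]) f i y) = cst 0.
    by apply/funext => y; rewrite big_nil.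
  by apply: is_diff_eq; apply/funext => y; rewrite big_nil.
have -> : (fun y => \sum_(i <- i :: s) f i y) =
    f i + (fun y => \sum_(i <- s) f i y).
  by apply/funext => y; rewrite big_cons.
by apply: is_diff_eq; apply/funext => y; rewrite big_cons.
Qed.

Lemma is_diff_coord p q (E : normedModType R) (v dv : E -> 'M[R]_(p, q)) x i j :
  is_diff x v dv -> is_diff x (fun y => v y i j) (fun h => dv h i j).
Proof.
move=> dvx.
have lc : linear (fun N : 'M[R]_(p, q) => N i j : R).
  by move=> a M N; rewrite !mxE.
have dc y : is_diff y (fun N : 'M[R]_(p, q) => N i j : R) (fun N => N i j).
  exact: is_diff_linear lc (@coord_continuous _ _ _ _ _).
exact: (@is_diff_comp _ _ _ _ v dv (fun N : 'M[R]_(p, q) => N i j)).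
Qed.

(** Expands a direction on fixed basis vectors, so that when [w] varies only scalar coefficients do.
    [iota] embeds a block of matrices in [E], such as one factor of a product. *)
Lemma derive_sum_delta p q E F (f : E -> F) (iota : 'M[R]_(p, q) -> E) x w :
  linear iota -> differentiable f x ->
  'D_(iota w) f x = \sum_i \sum_j w i j *: 'D_(iota (delta_mx i j)) f x.
Proof.
move=> li df.
pose g : {linear 'M[R]_(p, q) -> E} :=
  HB.pack iota (GRing.isLinear.Build _ _ _ _ _ li).
rewrite deriveE // [in LHS](matrix_sum_delta w) -[iota]/(g : _ -> _).
rewrite !linear_sum; apply: eq_bigr => i _; rewrite !linear_sum.
by apply: eq_bigr => j _; rewrite !linearZ deriveE.
Qed.

(** Product rule for a derivative whose base point and direction both move: moving the point yields
    a second derivative of [f], moving the direction a first one. *)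
Lemma is_diff_derive_along p q E F W (f : E -> F) (u du : W -> E)
    (iota : 'M[R]_(p, q) -> E) (v dv : W -> 'M[R]_(p, q)) x :
  linear iota -> smooth_at (u x) f -> is_diff x u du -> is_diff x v dv ->
  is_diff x (fun y => 'D_(iota (v y)) f (u y))
    (fun h => 'D_(du h) ('D_(iota (v x)) f) (u x) + 'D_(iota (dv h)) f (u x)).
Proof.
move=> li fux dux dvx.
have cu : {for x, continuous u} by apply: differentiable_continuous.
have fuy : \forall y \near x, smooth_at (u y) f.
  by apply: (cu [set z | smooth_at z f]); exact: near_smooth_at.
have df vs z : smooth_at z f -> differentiable (dderiv f vs) z.
  exact: smooth_at_diff.
have dfe w : differentiable ('D_w f) (u x) by exact: (df [:: w]).
apply: (@is_diff_near_eq _ _ _ (fun y =>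
    \sum_i \sum_j v y i j *: 'D_(iota (delta_mx i j)) f (u y))).
  apply: filterS fuy => y fy.
  by rewrite [RHS]derive_sum_delta //; exact: (df [::]).
apply: is_diff_eq.
  apply: is_diff_sum => i; apply: is_diff_sum => j.
  apply: is_diff_scale; first exact: is_diff_coord.
  apply: (@is_diff_comp _ _ _ _ u du ('D_(iota (delta_mx i j)) f)).
  exact: differentiableP.
apply/funext => h /=.
rewrite [X in _ = _ + X]derive_sum_delta //; last exact: (df [::]).
under eq_bigr do rewrite big_split /=.
rewrite big_split /=; congr (_ + _).
have dD : is_diff (u x) ('D_(iota (v x)) f) (fun h =>
    \sum_i \sum_j (v x i j *: 'd ('D_(iota (delta_mx i j)) f) (u x) h)).
  apply: (@is_diff_near_eq _ _ _ (fun y =>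
    \sum_i \sum_j (v x i j *: 'D_(iota (delta_mx i j)) f y))).
    apply: filterS (near_smooth_at fux) => y fy.
    by rewrite [RHS]derive_sum_delta //; exact: (df [::]).
  apply: is_diff_sum => i; apply: is_diff_sum => j.
  have -> : (fun y => v x i j *: 'D_(iota (delta_mx i j)) f y) =
    v x i j *: 'D_(iota (delta_mx i j)) f by [].
  by apply: is_diff_eq; first by apply: is_diffZ; exact: differentiableP.
by rewrite (is_diff_derive _ dD).
Qed.

Lemma is_derive_line E F (f : E -> F) (a v : E) (t : R) :
  differentiable f (a + t *: v) ->
  is_derive t 1 (fun t => f (a + t *: v)) ('D_v f (a + t *: v)).
Proof.
move=> df.
have du : is_diff t (fun t => a + t *: v) ( *:%R^~ v).
  have -> : (fun t => a + t *: v) = cst a + *:%R^~ v by [].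
  by apply: is_diff_eq; rewrite add0r.
have dfl : is_diff t (f \o (fun t => a + t *: v))
    ('d f (a + t *: v) \o *:%R^~ v).
  by apply: is_diff_comp; exact: differentiableP.
apply: DeriveDef; first by apply: diff_derivable.
by rewrite (is_diff_derive _ dfl) /= scale1r deriveE.
Qed.

(** Two applications of the mean value theorem, along [u] and then along [v], write the double
    difference as [s ^+ 2] times the mixed derivative at a point close to [x], and that derivative
    is continuous at [x]. *)
Lemma second_difference E (f : E -> R) (x u v : E) (e : R) :
  smooth_at x f -> 0 < e -> \forall s \near (0 : R)^'+,
  `|f (x + s *: u + s *: v) - f (x + s *: u) - f (x + s *: v) + f x
    - s ^+ 2 * 'D_v ('D_u f) x| <= e * s ^+ 2.
Proof.
move=> fx e0.
have cD : {for x, continuous ('D_v ('D_u f))}.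
  exact/differentiable_continuous/(smooth_at_diff [:: v; u] fx).
have cDe : \forall y \near x,
    `|'D_v ('D_u f) y - 'D_v ('D_u f) x| <= e.
  by move/cvgrPdistC_le : cD => /(_ _ e0).
have /nbhs_ballP[r /= r0 xr] : nbhs x [set y | smooth_at y f /\
    `|'D_v ('D_u f) y - 'D_v ('D_u f) x| <= e].
  by apply: filterI cDe; exact: near_smooth_at.
(* [s * k] bounds the norm of every displacement [a *: u + b *: v] with [a] and [b] between 0 and
   [s]; the summand 1 makes [k] positive. *)
pose k := `|u| + `|v| + 1.
have k0 : 0 < k by rewrite ltr_wpDl ?addr_ge0.
near=> s.
have s0 : 0 < s by near: s; exact: nbhs_right_gt.
have sr : s * k < r.
  by rewrite -ltr_pdivlMr //; near: s; apply: nbhs_right_lt; rewrite divr_gt0.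
have xrst a b : 0 <= a <= s -> 0 <= b <= s -> ball x r (x + a *: u + b *: v).
  move=> /andP[a0 als] /andP[b0 bs]; rewrite -ball_normE /= -addrA.
  rewrite opprD addNKr normrN; apply: le_lt_trans sr.
  apply: le_trans (ler_normD _ _) _; rewrite !normrZ !ger0_norm // /k.
  rewrite !mulrDr mulr1; apply: ler_wpDr; first exact: ltW.
  by apply: lerD; apply: ler_wpM2r.
have dvw vs a b : 0 <= a <= s -> 0 <= b <= s ->
    differentiable (dderiv f vs) (x + a *: u + b *: v).
  by move=> ha hb; apply: smooth_at_diff; exact: (xr _ (xrst _ _ ha hb)).1.
have hs : 0 <= s <= s by rewrite lexx (ltW s0).
have h0 : 0 <= (0 : R) <= s by rewrite lexx (ltW s0).
have itvP' t : t \in `]0, s[ -> 0 <= t <= s.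
  by rewrite in_itv /= => /andP[/ltW -> /ltW ->].
have itvP2 t : t \in `[0, s] -> 0 <= t <= s by rewrite in_itv.
have swp a b : x + a *: u + b *: v = x + b *: v + a *: u by rewrite addrAC.
have d1 t : 0 <= t <= s ->
  is_derive t 1 (fun t => f (x + s *: v + t *: u) - f (x + t *: u))
    ('D_u f (x + s *: v + t *: u) - 'D_u f (x + t *: u)).
  move=> ht; apply: is_deriveB; apply: is_derive_line.
    by rewrite -swp; exact: (dvw [::]).
  by rewrite -[_ + _]addr0 -(scale0r v); exact: (dvw [::]).
have wc (g dg : R -> R) : (forall t, 0 <= t <= s -> is_derive t 1 g (dg t)) ->
    {within `[0, s], continuous g}.
  move=> hg; apply: derivable_within_continuous => t /itvP2 ht.
  exact: (@ex_derive _ _ _ _ _ _ _ (hg _ ht)).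
have [c /itvP' hc Hc] := MVT s0 (fun t ht => d1 t (itvP' t ht)) (wc _ _ d1).
have d2 t : 0 <= t <= s ->
  is_derive t 1 (fun t => 'D_u f (x + c *: u + t *: v))
    ('D_v ('D_u f) (x + c *: u + t *: v)).
  by move=> ht; apply: is_derive_line; exact: (dvw [:: u]).
have [d /itvP' hd Hd] := MVT s0 (fun t ht => d2 t (itvP' t ht)) (wc _ _ d2).
have -> : f (x + s *: u + s *: v) - f (x + s *: u) - f (x + s *: v) + f x =
    s ^+ 2 * 'D_v ('D_u f) (x + c *: u + d *: v).
  move: Hd; rewrite scale0r addr0 subr0 => Hd.
  move: Hc; rewrite -(swp c s) Hd !scale0r !addr0 subr0 -(swp s s) => Hc.
  by rewrite expr2; lra.
rewrite -mulrBr normrM (ger0_norm (exprn_ge0 2 (ltW s0))) [leLHS]mulrC.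
apply: ler_wpM2r; first exact: exprn_ge0 (ltW s0).
exact: (xr _ (xrst _ _ hc hd)).2.
Unshelve. all: by end_near. Qed.

(** The double difference is symmetric in [u] and [v], and approximates both mixed derivatives times
    [s ^+ 2] up to [e / 2 * s ^+ 2]; hence they differ by at most [e]. *)
Lemma deriveC_real E (f : E -> R) (x u v : E) :
  smooth_at x f -> 'D_v ('D_u f) x = 'D_u ('D_v f) x.
Proof.
move=> fx; apply/eqP; rewrite -subr_eq0 -normr_le0; apply/ler_addgt0Pl => e e0.
rewrite addr0.
have e2 : 0 < e / 2 by rewrite divr_gt0.
have h1 := second_difference u v fx e2.
have h2 := second_difference v u fx e2.
have h0 : \forall s \near (0 : R)^'+, 0 < s by exact: nbhs_right_gt.
have [s [[{}h1 {}h2] s0]] := filter_ex (filterI (filterI h1 h2) h0).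
have s20 : 0 < s ^+ 2 by rewrite exprn_gt0.
rewrite -(ler_pM2l s20); rewrite /= in h1 h2.
rewrite [x + s *: v + s *: u]addrAC [_ - _ - f (x + s *: u)]addrAC in h2.
set D := _ - _ + f x in h1 h2.
move: ('D_v ('D_u f) x) ('D_u ('D_v f) x) D h1 h2 => A B D h1 h2.
have -> : s ^+ 2 * `|A - B| = `|(D - s ^+ 2 * B) - (D - s ^+ 2 * A)|.
  by rewrite -[X in X * _](ger0_norm (ltW s20)) -normrM; congr `|_|; ring.
apply: le_trans (ler_normB _ _) _.
have -> : s ^+ 2 * e = e / 2 * s ^+ 2 + e / 2 * s ^+ 2 by field.
exact: lerD.
Qed.

Lemma deriveC p q E (f : E -> 'M[R]_(p, q)) (x u v : E) :
  smooth_at x f -> 'D_v ('D_u f) x = 'D_u ('D_v f) x.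
Proof.
move=> fx; apply/matrixP => i j.
have coordS (g : E -> 'M[R]_(p, q)) y w : differentiable g y ->
    ('D_w g y) i j = 'D_w (fun z => g z i j) y.
  by move=> dg; rewrite derive_mx ?mxE //; exact: diff_derivable.
have fij : smooth_at x (fun z => f z i j).
  have key vs y : smooth_at y f ->
      dderiv (fun z => f z i j) vs y = dderiv f vs y i j.
    elim: vs y => [//|w vs IH] y fy /=.
    rewrite (@near_eq_derive _ _ _ _ (fun z => dderiv f vs z i j)).
      by rewrite coordS //; exact: smooth_at_diff.
    by apply: filterS (near_smooth_at fy) => z; exact: IH.
  apply: filterS (near_join (near_smooth_at fx)) => y fy vs.
  apply: near_eq_differentiable; first by apply: filterS fy => z /key ->.
  have := is_diff_coord i j
    (differentiableP (smooth_at_diff vs (nbhs_singleton fy))).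
  by case.
have key w1 w2 : ('D_w1 ('D_w2 f) x) i j = 'D_w1 ('D_w2 (fun z => f z i j)) x.
  rewrite coordS; last exact: (smooth_at_diff [:: w2] fx).
  apply: near_eq_derive; apply: filterS (near_smooth_at fx) => y fy.
  by rewrite coordS //; exact: smooth_at_differentiable.
apply: etrans (key v u) _; apply: etrans (esym (key u v)).
exact: (deriveC_real u v fij).
Qed.

End SecondOrder.

(** * The Lie algebra of a local group law *)

Section LocalGroup.
Context (R : realType) (n : nat).
Let V : normedModType R := 'rV[R]_n.
Variables (m : V * V -> V) (x0 : V).
Hypothesis m_smooth : smooth_at (x0, x0) m.
Hypothesis m1 : \forall x \near x0, m (x, x0) = x.
Hypothesis m0 : \forall y \near x0, m (x0, y) = y.
Hypothesis mA : \forall p \near (x0, (x0, x0)),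
  m (m (p.1, p.2.1), p.2.2) = m (p.1, m p.2).

(** The bilinear term of the second order expansion of the law at the unit; [a] belongs to the first
    factor, [b] to the second. *)
Definition law_hess (a b : V) : V := 'D_(0, b) ('D_(a, 0) m) (x0, x0).

Lemma near_pairl (T U : topologicalType) (a : T) (b : U) (P : T * U -> Prop) :
  (\forall p \near (a, b), P p) -> \forall y \near b, P (a, y).
Proof.
move=> Pab.
have c : (fun y : U => (a, y)) @ b --> (a, b).
  by apply: cvg_pair; [exact: cvg_cst|exact: cvg_id].
exact: (c _ Pab).
Qed.

Lemma near_pairr (T U : topologicalType) (a : T) (b : U) (P : T * U -> Prop) :
  (\forall p \near (a, b), P p) -> \forall x \near a, P (x, b).
Proof.
move=> Pab.
have c : (fun x : T => (x, b)) @ a --> (a, b).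
  by apply: cvg_pair; [exact: cvg_id|exact: cvg_cst].
exact: (c _ Pab).
Qed.

Let inl_lin : linear (fun a : V => (a, 0) : V * V).
Proof.
by move=> k a b; apply: injective_projections; rewrite /= ?scaler0 ?addr0.
Qed.

Let inr_lin : linear (fun a : V => (0, a) : V * V).
Proof.
by move=> k a b; apply: injective_projections; rewrite /= ?scaler0 ?addr0.
Qed.

Let is_diff_inl (y z : V) :
  is_diff y (fun x : V => (x, z) : V * V) (fun h => (h, 0)).
Proof. by apply: is_diff_eq. Qed.

Let is_diff_inr (y z : V) :
  is_diff z (fun x : V => (y, x) : V * V) (fun h => (0, h)).
Proof. by apply: is_diff_eq. Qed.

Lemma is_diff_comp_inl (F : normedModType R) (f : V * V -> F) y z :
  differentiable f (y, z) ->
  is_diff y (fun x => f (x, z)) (fun h => 'D_(h, 0) f (y, z)).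
Proof.
move=> df; have -> : (fun x => f (x, z)) = f \o (fun x => (x, z)) by [].
apply: is_diff_eq; first by apply: is_diff_comp; exact: differentiableP.
by apply/funext => h /=; rewrite deriveE.
Qed.

Lemma is_diff_comp_inr (F : normedModType R) (f : V * V -> F) y z :
  differentiable f (y, z) ->
  is_diff z (fun x => f (y, x)) (fun h => 'D_(0, h) f (y, z)).
Proof.
move=> df; have -> : (fun x => f (y, x)) = f \o (fun x => (y, x)) by [].
apply: is_diff_eq; first by apply: is_diff_comp; exact: differentiableP.
by apply/funext => h /=; rewrite deriveE.
Qed.

(** The local right invariant field with value [a] at the unit: the derivative at [x0] of right
    multiplication by [y], applied to [a]. *)
Let field (a y : V) : V := 'D_(a, 0) m (x0, y).

Let m_smooth0 : \forall y \near x0, smooth_at (x0, y) m.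
Proof. exact: near_pairl (near_smooth_at m_smooth). Qed.

Let is_diff_field a y : smooth_at (x0, y) m ->
  is_diff y (field a) (fun h => 'D_(0, h) ('D_(a, 0) m) (x0, y)).
Proof.
by move=> sm; apply: is_diff_comp_inr; exact: (smooth_at_diff [:: (a, 0)] sm).
Qed.

Lemma law_field0 a : 'D_(a, 0) m (x0, x0) = a.
Proof.
have d1 : is_diff x0 (fun x => m (x, x0)) (fun h => 'D_(h, 0) m (x0, x0)).
  by apply: is_diff_comp_inl; exact: smooth_at_differentiable.
have d2 : is_diff x0 idfun (fun h => 'D_(h, 0) m (x0, x0)).
  exact: is_diff_near_eq d1.
by rewrite -(is_diff_derive a d2) derive_id.
Qed.

Let field0 a : field a x0 = a.
Proof. exact: law_field0. Qed.

(* Derivative of the associativity law in its first argument. *)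
Let field_invariant a : \forall p \near (x0, x0),
  'D_(field a p.1, 0) m p = field a (m p).
Proof.
have cm : {for (x0, x0), continuous m}.
  exact/differentiable_continuous/smooth_at_differentiable.
have m00 : m (x0, x0) = x0 by exact: (nbhs_singleton m0).
have sm : \forall p \near (x0, x0), smooth_at p m.
  exact: near_smooth_at m_smooth.
have sm3 : \forall p \near (x0, x0), smooth_at (x0, m p) m.
  by apply: (cm [set y | smooth_at (x0, y) m]); rewrite m00.
have sm1 : \forall p \near (x0, x0), smooth_at (x0, p.1) m.
  by exists ([set y | smooth_at (x0, y) m], setT) => [|p []//]; split=> //=;
    exact: filterT.
have m01 : \forall p \near (x0, x0), m (x0, p.1) = p.1.
  by exists ([set y | m (x0, y) = y], setT) => [|p []//]; split=> //=;
    exact: filterT.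
(* The neighbourhood of triples is sliced: for [p] fixed near [(x0, x0)], associativity holds for
   all [x] near [x0], so it can be derived in [x]. *)
have mAp : \forall p \near (x0, x0), \forall x \near x0,
    m (m (x, p.1), p.2) = m (x, m p).
  by apply: filterS (near_pairl (near_join mA)) => p /near_pairr.
apply: filterS (filterI (filterI sm sm1) (filterI sm3 (filterI m01 mAp))).
move=> p [[sp sp1] [sp3 [p01 pA]]].
have d1 : is_diff x0 (fun x => m (m (x, p.1), p.2))
    (fun h => 'D_(field h p.1, 0) m p).
  apply: is_diff_eq.
    apply: (@is_diff_comp _ _ _ _ (fun x => m (x, p.1)) _
      (fun y => m (y, p.2))).
      by apply: is_diff_comp_inl; exact: smooth_at_differentiable.
    by apply: is_diff_comp_inl; rewrite p01 -surjective_pairing;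
      exact: smooth_at_differentiable.
  by apply/funext => h /=; rewrite p01 -surjective_pairing.
have d2 : is_diff x0 (fun x => m (x, m p)) (fun h => 'D_(field h p.1, 0) m p).
  exact: is_diff_near_eq pA d1.
have d3 : is_diff x0 (fun x => m (x, m p)) (fun h => 'D_(h, 0) m (x0, m p)).
  by apply: is_diff_comp_inl; exact: smooth_at_differentiable.
by rewrite /field -(is_diff_derive a d2) (is_diff_derive a d3).
Qed.

(** Derivative of [field_invariant] at [(y, z)] in [y], taken at [y = x0] along [b]. On the left
    both the point and the direction [field a y] move, the latter at rate [law_hess a b]; on the
    right the chain rule passes through [m]. *)
Let field_hess a b : \forall z \near x0,
  'D_(b, 0) ('D_(a, 0) m) (x0, z) + 'D_(law_hess a b, 0) m (x0, z)
  = 'D_(0, field b z) ('D_(a, 0) m) (x0, z).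
Proof.
have inv := near_pairl (near_join (field_invariant a)).
apply: filterS (filterI m_smooth0 (filterI m0 inv)) => z [sz [m0z invz]].
have d1 : is_diff x0 (fun y => 'D_(field a y, 0) m (y, z))
    (fun h => 'D_(h, 0) ('D_(a, 0) m) (x0, z)
              + 'D_(law_hess a h, 0) m (x0, z)).
  apply: is_diff_eq.
    apply: (is_diff_derive_along inl_lin sz (is_diff_inl x0 z)).
    exact: is_diff_field.
  by apply/funext => h; rewrite field0.
have d2 : is_diff x0 (fun y => field a (m (y, z)))
    (fun h => 'D_(h, 0) ('D_(a, 0) m) (x0, z)
              + 'D_(law_hess a h, 0) m (x0, z)).
  exact: is_diff_near_eq (near_pairr invz) d1.
have d3 : is_diff x0 (fun y => field a (m (y, z)))
    (fun h => 'D_(0, field h z) ('D_(a, 0) m) (x0, z)).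
  have dmz : is_diff x0 (fun y => m (y, z)) (fun h => field h z).
    by apply: is_diff_comp_inl; exact: smooth_at_differentiable.
  have dfz : is_diff (m (x0, z)) (field a)
      (fun h => 'D_(0, h) ('D_(a, 0) m) (x0, z)).
    by rewrite m0z; exact: is_diff_field.
  exact: (is_diff_comp dmz dfz).
by rewrite -(is_diff_derive b d2) (is_diff_derive b d3).
Qed.

Lemma law_hess_linl b : linear (law_hess ^~ b).
Proof.
move=> k u v; rewrite /law_hess.
have d w : is_diff (x0, x0) ('D_w m) ('d ('D_w m) (x0, x0)).
  by apply: differentiableP; exact: (smooth_at_diff [:: w] m_smooth).
have e : is_diff (x0, x0) (k *: 'D_(u, 0) m + 'D_(v, 0) m)
   (k *: ('d ('D_(u, 0) m) (x0, x0) : _ -> _) + 'd ('D_(v, 0) m) (x0, x0)).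
  by apply: is_diffD.
(* Linearity in the inner direction holds at all points near [(x0, x0)], so it passes through the
   outer derivative. *)
have e' : is_diff (x0, x0) ('D_(k *: u + v, 0) m)
   (k *: ('d ('D_(u, 0) m) (x0, x0) : _ -> _) + 'd ('D_(v, 0) m) (x0, x0)).
  apply: is_diff_near_eq e; apply: filterS (near_smooth_at m_smooth) => p sp.
  by rewrite inl_lin (derive_lin (smooth_at_differentiable sp)).
apply: etrans (is_diff_derive (0, b) e') _.
exact: esym (congr2 (fun x y : V => k *: x + y)
  (is_diff_derive (0, b) (d (u, 0))) (is_diff_derive (0, b) (d (v, 0)))).
Qed.

Lemma law_hess_linr a : linear (law_hess a).
Proof.
move=> k u v; rewrite /law_hess inr_lin derive_lin //.
exact: (smooth_at_diff [:: (a, 0)] m_smooth).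
Qed.

(* Derivative of [field_invariant] in its two arguments. *)
Lemma law_hess_assoc a b c :
  'D_(0, c) ('D_(b, 0) ('D_(a, 0) m)) (x0, x0) + law_hess (law_hess a b) c
  = 'D_(0, c) ('D_(0, b) ('D_(a, 0) m)) (x0, x0) + law_hess a (law_hess b c).
Proof.
have dm vs : differentiable (dderiv m vs) (x0, x0) by exact: smooth_at_diff.
have d1 : is_diff x0 (fun z => 'D_(b, 0) ('D_(a, 0) m) (x0, z)
    + 'D_(law_hess a b, 0) m (x0, z))
  (fun c => 'D_(0, c) ('D_(b, 0) ('D_(a, 0) m)) (x0, x0)
            + law_hess (law_hess a b) c).
  apply: is_diffD; apply: is_diff_comp_inr.
    exact: (dm [:: (b, 0); (a, 0)]).
  exact: (dm [:: (law_hess a b, 0)]).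
have d2 := is_diff_near_eq (field_hess a b) d1.
have d3 := is_diff_derive_along inr_lin
  (smooth_at_derive (a, 0) m_smooth) (is_diff_inr x0 x0)
  (is_diff_field b m_smooth).
have := is_diff_derive c d2; rewrite (is_diff_derive c d3) field0.
by move=> /esym.
Qed.

(** [law_hess a] is the derivative at [x0] of the right invariant field [field a], so this is the
    Jacobi-Lie bracket of [field a] and [field b] at [x0]; hence the order of the two terms. *)
Definition law_bracket (a b : V) : V := law_hess b a - law_hess a b.

Lemma law_bracket_linr a : linear (law_bracket a).
Proof.
move=> k u v.
apply: etrans (congr2 (fun x y : V => x - y)
  (law_hess_linl a k u v) (law_hess_linr a k u v)) _.
rewrite /law_bracket; move: law_hess => B.
by rewrite scalerBr opprD addrACA.
Qed.

(* The associator of [law_hess] is a sum of two third derivatives, of which one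
   is symmetric in [a, b] and the other in [b, c]; its alternating sum, which
   is the Jacobiator, vanishes. *)
Lemma law_bracket_jacobi a b c :
  law_bracket a (law_bracket b c) + law_bracket b (law_bracket c a)
  + law_bracket c (law_bracket a b) = 0.
Proof.
pose T u v w := 'D_(0, w) ('D_(v, 0) ('D_(u, 0) m)) (x0, x0).
pose S u v w := 'D_(0, w) ('D_(0, v) ('D_(u, 0) m)) (x0, x0).
(* For [T] the symmetry is applied under the outer derivative, so it must hold on a neighbourhood;
   for [S] the two outer derivatives commute at the point itself. *)
have TC u v w : T u v w = T v u w.
  apply: near_eq_derive; apply: filterS (near_smooth_at m_smooth) => p sp.
  exact: (deriveC (u, 0) (v, 0) sp).
have SC u v w : S u v w = S u w v.
  exact: (deriveC (0, v) (0, w) (smooth_at_derive _ m_smooth)).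
have A u v w : T u v w + law_hess (law_hess u v) w
    = S u v w + law_hess u (law_hess v w) by exact: law_hess_assoc.
have subl u v w : law_hess (u - v) w = law_hess u w - law_hess v w.
  rewrite [u - v]addrC -scaleN1r; apply: etrans (law_hess_linl w (-1) v u) _.
  by rewrite scaleN1r addrC.
have subr u v w : law_hess u (v - w) = law_hess u v - law_hess u w.
  rewrite [v - w]addrC -scaleN1r; apply: etrans (law_hess_linr u (-1) w v) _.
  by rewrite scaleN1r addrC.
rewrite /law_bracket; clearbody T S.
move: law_hess A subl subr => B A subl subr; rewrite !subl !subr.
apply/rowP => k.
have Ak u v w := congr1 (fun x : V => x 0 k) (A u v w).
(* The six orderings of the associator identity, signed by the permutation, add up to the Jacobi
   identity once the terms in [T] and in [S] cancel in pairs. *)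
move: (Ak a b c) (Ak b c a) (Ak c a b) (Ak b a c) (Ak a c b) (Ak c b a).
rewrite (TC b a) (TC c b) (TC c a) (SC a c b) (SC b c a) (SC c b a) !mxE.
by lra.
Qed.

End LocalGroup.

(** * Tangent maps and Lie groups *)

Section Manifold.
Context (R : realType).

(** Continuity is part of the notion: [local_rep] is meaningful near the base point only when [f]
    keeps nearby points in the domain of the chart at [f p]. *)
Definition mdiff (E F : normedModType R) (M : manifold E) (N : manifold F)
    (f : M -> N) (p : M) : Prop :=
  {for p, continuous f} /\ differentiable (local_rep f p) (chart p p).

Lemma smooth_map_mdiff (E F : normedModType R) (M : manifold E)
  (N : manifold F) (f : M -> N) p : smooth_map f -> mdiff f p.
Proof.
by move=> [cf sf]; split; [exact: cf|exact: smooth_at_differentiable].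
Qed.

Lemma chart_near (E : normedModType R) (M : manifold E) (p q : M) :
  cdom p q -> \forall x \near chart p q,
    cdom p (unchart p x) /\ chart p (unchart p x) = x.
Proof.
move=> pq; have : nbhs (chart p q) (chart p @` cdom p).
  by apply: open_nbhs_nbhs; split; [exact: cimg_open|exists q].
by apply: filterS => _ [a pa <-]; rewrite chartK.
Qed.

Lemma unchart_near (E : normedModType R) (M : manifold E) (p q : M)
    (P : set M) :
  cdom p q -> nbhs q P -> \forall x \near chart p q, P (unchart p x).
Proof.
move=> pq Pq.
have c : {for chart p q, continuous (unchart p)}.
  by apply: unchart_continuous; exists q.
by apply: c; rewrite chartK.
Qed.

Lemma cdom_near (E : normedModType R) (M : manifold E) (p q : M) :
  cdom p q -> nbhs q (cdom p).
Proof. by move=> pq; apply: open_nbhs_nbhs; split => //; exact: cdom_open. Qed.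

Lemma local_rep_at (E F : normedModType R) (M : manifold E) (N : manifold F)
    (f : M -> N) p :
  local_rep f p (chart p p) = chart (f p) (f p).
Proof. by rewrite /local_rep /= chartK //; exact: mem_cdom. Qed.

Lemma is_diff_local_rep (E F : normedModType R) (M : manifold E)
    (N : manifold F) (f : M -> N) p : mdiff f p ->
  is_diff (chart p p) (local_rep f p) (tmap f p).
Proof. by move=> [_ df]; exact: differentiableP. Qed.

Section Comp.
Context (E F H : normedModType R) (M : manifold E) (N : manifold F)
  (P : manifold H).

(** By continuity [f] sends nearby points into the domain of the chart at [f p], where [unchart]
    undoes [chart]. *)
Lemma local_rep_comp (f : M -> N) (g : N -> P) p : {for p, continuous f} ->
  \forall x \near chart p p,
    local_rep g (f p) (local_rep f p x) = local_rep (g \o f) p x.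
Proof.
move=> cf; have := cf _ (cdom_near (mem_cdom (f p))).
move=> /(unchart_near (mem_cdom p)); apply: filterS => x /= fx.
by rewrite /local_rep /= chartK.
Qed.

Lemma mdiff_comp (f : M -> N) (g : N -> P) p :
  mdiff f p -> mdiff g (f p) ->
  mdiff (g \o f) p /\
  (forall v, tmap (g \o f) p v = tmap g (f p) (tmap f p v)).
Proof.
move=> df dg.
have d : is_diff (chart p p) (local_rep (g \o f) p)
    (tmap g (f p) \o tmap f p).
  apply: is_diff_near_eq (local_rep_comp g df.1) _.
  apply: (@is_diff_comp _ _ _ _ (local_rep f p) _ (local_rep g (f p))).
    exact: is_diff_local_rep.
  by rewrite local_rep_at; exact: is_diff_local_rep.
split; last by move=> v; exact: (is_diff_Ediff v d).
split; last by case: d.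
by apply: continuous_comp; [exact: df.1|exact: dg.1].
Qed.

End Comp.

Lemma tmap_id (E : normedModType R) (M : manifold E) (p : M) v :
  tmap (idfun : M -> M) p v = v.
Proof.
have d : is_diff (chart p p) (local_rep (idfun : M -> M) p) (idfun : E -> E).
  apply: (@is_diff_near_eq _ E E idfun).
  by apply: filterS (chart_near (mem_cdom p)) => x [].
exact: (is_diff_Ediff v d).
Qed.

Lemma tmap_linear (E F : normedModType R) (M : manifold E) (N : manifold F)
  (f : M -> N) p (a : R) (u v : E) :
  tmap f p (a *: u + v) = a *: (tmap f p u : F) + tmap f p v.
Proof. exact: linearP. Qed.

End Manifold.

(** * Lie groups: right translations and the Lie bracket *)

Section LieGroup.
Context (R : realType) (n : nat) (G : lieGroup R n).

Lemma lmulgV (g : G) : lmul g (linv g) = lone.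
Proof.
rewrite -[LHS]lmul1g -{1}(lmulVg (linv g)) -lmulA (lmulA _ g) lmulVg.
by rewrite lmul1g lmulVg.
Qed.

Lemma lmulg1 (g : G) : lmul g lone = g.
Proof. by rewrite -(lmulVg g) lmulA lmulgV lmul1g. Qed.

Lemma linvM (g h : G) : linv (lmul g h) = lmul (linv h) (linv g).
Proof.
rewrite -[RHS]lmul1g -(lmulVg (lmul g h)) -!lmulA (lmulA h) lmulgV lmul1g.
by rewrite lmulgV lmulg1.
Qed.

(** Right translation by [h] is the multiplication restricted to the slice of pairs [(x, h)], which
    is affine in the product chart. *)
Lemma mdiff_rtrans (g h : G) : mdiff (rtrans h) g.
Proof.
have [cm sm] := lmul_smooth G.
split.
  have c : (fun x : G => (x, h)) @ g --> (g, h).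
    by apply: cvg_pair; [exact: cvg_id|exact: cvg_cst].
  exact: (cvg_comp _ _ c (cm (g, h))).
have dm := smooth_at_differentiable (sm (g, h)).
pose u (x : 'rV[R]_n) : 'rV[R]_n * 'rV[R]_n := (x, chart h h).
have du : is_diff (chart g g) u (fun v => (v, 0)) by apply: is_diff_eq.
have -> : local_rep (rtrans h) g =
    local_rep (M := prod_mfd G G) (N := G) (fun p => lmul p.1 p.2) (g, h) \o u.
  apply/funext => x; rewrite /local_rep /= /rtrans /prod_fun /u /=.
  by rewrite chartK //; exact: mem_cdom.
by apply: differentiable_comp.
Qed.

Lemma tmap_rtransM (g h k : G) v :
  tmap (rtrans k) (lmul g h) (tmap (rtrans h) g v) =
  tmap (rtrans (lmul h k)) g v.
Proof.
have [_ <-] := mdiff_comp (mdiff_rtrans g h) (mdiff_rtrans (lmul g h) k).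
congr (tmap _ g v); apply/funext => x.
by rewrite /rtrans /= lmulA.
Qed.

Lemma tmap_rtrans1 (g : G) v : tmap (rtrans lone) g v = v.
Proof.
have -> : rtrans lone = (idfun : G -> G).
  by apply/funext => x; rewrite /rtrans lmulg1.
exact: tmap_id.
Qed.

Lemma rtriv_rinv_field (g : G) (a : lieAlg R n) :
  rtriv G g (rinv_field a g) = a.
Proof.
have := @tmap_rtransM lone g (linv g) a.
by rewrite lmul1g lmulgV tmap_rtrans1.
Qed.

Lemma rinv_field_rtriv (g : G) (v : tangent g) : rinv_field (rtriv G g v) g = v.
Proof.
have := @tmap_rtransM g (linv g) g v.
by rewrite lmulgV lmulVg tmap_rtrans1.
Qed.

(** Right invariance of the trivialization, the source of the invariance of [tulczyjew]. *)
Lemma rtriv_rtrans (g h : G) (v : tangent g) :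
  rtriv G (lmul g h) (tmap (rtrans h) g v) = rtriv G g v.
Proof. by rewrite /rtriv tmap_rtransM linvM lmulA lmulgV lmul1g. Qed.

Let x0 : 'rV[R]_n := chart (lone : G) lone.
(** The total functions [chart] and [unchart] make this a group law only near [(x0, x0)], which is
    why the local theory assumes the axioms near the unit. *)
Let m (p : 'rV[R]_n * 'rV[R]_n) : 'rV[R]_n :=
  chart lone (lmul (unchart lone p.1) (unchart lone p.2) : G).

Let m_smooth : smooth_at (x0, x0) m.
Proof.
have [_ /(_ (lone, lone))] := lmul_smooth G.
by rewrite /local_rep /= lmul1g.
Qed.

Let near_lone : \forall x \near x0,
  cdom (lone : G) (unchart lone x) /\ chart (lone : G) (unchart lone x) = x.
Proof. exact: chart_near (mem_cdom _). Qed.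

Let unchart0 : unchart lone x0 = lone :> G.
Proof. by rewrite chartK //; exact: mem_cdom. Qed.

Let m1 : \forall x \near x0, m (x, x0) = x.
Proof.
by apply: filterS near_lone => x [_ xE]; rewrite /m /= unchart0 lmulg1.
Qed.

Let m0 : \forall y \near x0, m (x0, y) = y.
Proof.
by apply: filterS near_lone => x [_ xE]; rewrite /m /= unchart0 lmul1g.
Qed.

Let near_mul : \forall p \near (x0, x0),
  cdom (lone : G) (lmul (unchart lone p.1) (unchart lone p.2)).
Proof.
have [cm _] := lmul_smooth G.
have := cm (lone, lone) (cdom lone).
rewrite /= lmul1g => /(_ (cdom_near (mem_cdom _))).
exact: (@unchart_near _ _ (prod_mfd G G) (lone, lone) (lone, lone)
  [set q | cdom lone (lmul q.1 q.2)] (mem_cdom _)).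
Qed.

(** Intermediate products must lie in the chart domain for [unchart] to cancel [chart]; [near_mul]
    ensures it for both ways of bracketing. *)
Let mA : \forall p \near (x0, (x0, x0)),
  m (m (p.1, p.2.1), p.2.2) = m (p.1, m p.2).
Proof.
have h1 : \forall p \near (x0, (x0, x0)),
    cdom (lone : G) (lmul (unchart lone p.1) (unchart lone p.2.1)).
  have [[A B] [/= nA nB] AB] := near_mul.
  exists (A, B `*` setT) => [|[x [y z]] [/= Ax [By _]]]; last first.
    exact: (AB (x, y)).
  by split=> //=; exists (B, setT) => //; split=> //=; exact: filterT.
have h2 : \forall p \near (x0, (x0, x0)),
    cdom (lone : G) (lmul (unchart lone p.2.1) (unchart lone p.2.2)).
  exists (setT, [set q |
    cdom (lone : G) (lmul (unchart lone q.1) (unchart lone q.2))]).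
    by split=> /=; [exact: filterT|exact: near_mul].
  by move=> [x q] [].
apply: filterS (filterI h1 h2) => p [p1 p2].
by rewrite /m /= !chartK // lmulA.
Qed.

(** The field at [q] is read in [chart q] and carried to the chart at the identity by the transition
    map. That map composed with right translation by [q] is, near [x0], the function sending [y] to
    [m (y, x)], so both sides differentiate one germ. *)
Let vf_in_chart_rinv (a : lieAlg R n) : \forall x \near x0,
  vf_in_chart (rinv_field (G := G) a) lone x = 'D_(a, 0) m (x0, x).
Proof.
have sm := near_pairl (near_smooth_at m_smooth).
apply: filterS (filterI near_lone sm) => x [[xd xE] sx].
rewrite /vf_in_chart; set q := unchart lone x.
have dt : is_diff (chart q q) (chart (lone : G) \o unchart q)
    ('d (chart (lone : G) \o unchart q) (chart q q)).
  apply: differentiableP; apply: smooth_at_differentiable.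
  apply: chart_smooth; exists q => //; split=> //; exact: mem_cdom.
have q1 : rtrans q lone = q by exact: lmul1g.
have dr := is_diff_local_rep (mdiff_rtrans lone q).
have dtr : is_diff x0 ((chart (lone : G) \o unchart q) \o
    local_rep (rtrans q) lone)
    ('d (chart (lone : G) \o unchart q) (chart q q) \o tmap (rtrans q) lone).
  have e : local_rep (rtrans q) lone x0 = chart q q.
    exact: etrans (local_rep_at _ _) (congr1 (fun r => chart r r) q1).
  by rewrite -e in dt *; exact: (is_diff_comp dr dt).
have dm1 : is_diff x0 (fun y => m (y, x))
    ('d (chart (lone : G) \o unchart q) (chart q q) \o tmap (rtrans q) lone).
  apply: is_diff_near_eq dtr.
  have := (mdiff_rtrans lone q).1 (cdom q).
  rewrite q1 => /(_ (cdom_near (mem_cdom q))).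
  move=> /(unchart_near (mem_cdom lone)); apply: filterS => y /= yq.
  by rewrite /local_rep /= q1 chartK.
have dm2 : is_diff x0 (fun y => m (y, x)) (fun h => 'D_(h, 0) m (x0, x)).
  exact: is_diff_comp_inl (smooth_at_differentiable sx).
exact: etrans (esym (is_diff_Ediff a dm1)) (is_diff_Ediff a dm2).
Qed.

(** The local fields represent [rinv_field] near [x0], so values and first derivatives at [x0]
    agree; the bracket depends on these alone. *)
Lemma lie_bracketE (a b : lieAlg R n) :
  lie_bracket G a b = law_bracket m x0 a b.
Proof.
have dm (c : 'rV[R]_n) : is_diff x0 (fun x => 'D_(c, 0) m (x0, x))
    (fun h => law_hess m x0 c h).
  have dc := smooth_at_diff [:: (c, 0) : 'rV[R]_n * 'rV[R]_n] m_smooth.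
  exact: is_diff_comp_inr dc.
have dv (c : 'rV[R]_n) : is_diff x0 (vf_in_chart (rinv_field (G := G) c) lone)
    (fun h => law_hess m x0 c h).
  apply: is_diff_near_eq (dm c).
  by apply: filterS (vf_in_chart_rinv c) => x ->.
have v0 (c : 'rV[R]_n) : vf_in_chart (rinv_field (G := G) c) lone x0 = c.
  by rewrite (nbhs_singleton (vf_in_chart_rinv c)) law_field0.
rewrite /lie_bracket /jacobi_lie -/x0 !v0.
exact: (congr2 (fun x y : 'rV[R]_n => x - y)
  (is_diff_Ediff a (dv b)) (is_diff_Ediff b (dv a))).
Qed.

Lemma lie_bracketC (a b : lieAlg R n) : lie_bracket G a b = - lie_bracket G b a.
Proof. by rewrite /lie_bracket /jacobi_lie opprB. Qed.

Lemma lie_bracket_linr (a : lieAlg R n) : linear (lie_bracket G a).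
Proof.
move=> k u v; rewrite !lie_bracketE.
exact: law_bracket_linr.
Qed.

Lemma lie_bracket_jacobi (a b c : lieAlg R n) :
  lie_bracket G a (lie_bracket G b c) + lie_bracket G b (lie_bracket G c a)
  + lie_bracket G c (lie_bracket G a b) = 0.
Proof.
rewrite !lie_bracketE.
exact: (law_bracket_jacobi m_smooth m1 m0 mA).
Qed.

End LieGroup.

(** * The reduced bracket *)

Section ReducedBracket.
Context (R : realType) (n : nat) (G : lieGroup R n).
Let W := redSpace R n.
Implicit Types (h k j : W -> R) (w : W).

Lemma pairingE (mu : lieDual R n) (xi : lieAlg R n) :
  pairing mu xi = \sum_i xi 0 i * mu i 0.
Proof. by rewrite /pairing mxE. Qed.

Lemma pairing_linl (xi : lieAlg R n) (a : R) (mu nu : lieDual R n) :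
  pairing (a *: mu + nu) xi = a * pairing mu xi + pairing nu xi.
Proof. by rewrite /pairing linearP !mxE. Qed.

Lemma pairing_linr (mu : lieDual R n) (a : R) (xi eta : lieAlg R n) :
  pairing mu (a *: xi + eta) = a * pairing mu xi + pairing mu eta.
Proof. by rewrite /pairing mulmxDl -scalemxAl !mxE. Qed.

Lemma pairing0l (xi : lieAlg R n) : pairing 0 xi = 0.
Proof. by rewrite /pairing mulmx0 mxE. Qed.

Lemma pairing0r (mu : lieDual R n) : pairing mu 0 = 0.
Proof. by rewrite /pairing mul0mx mxE. Qed.

Lemma pairingNl (mu : lieDual R n) (xi : lieAlg R n) :
  pairing (- mu) xi = - pairing mu xi.
Proof. by rewrite /pairing mulmxN mxE. Qed.

Lemma pairingNr (mu : lieDual R n) (xi : lieAlg R n) :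
  pairing mu (- xi) = - pairing mu xi.
Proof. by rewrite /pairing mulNmx mxE. Qed.

Lemma pairing_delta (xi : lieAlg R n) i : pairing (delta_mx i 0) xi = xi 0 i.
Proof.
rewrite pairingE (bigD1 i) //= big1 ?addr0 ?mxE ?eqxx ?mulr1 // => l li.
by rewrite mxE (negPf li) mulr0.
Qed.

(** The coadjoint map [ad^*_a] at [nu], given by its values on the standard basis. *)
Definition coad (a : lieAlg R n) (nu : lieDual R n) : lieDual R n :=
  \col_i pairing nu (lie_bracket G a (delta_mx 0 i)).

Lemma pairing_coad a nu b :
  pairing (coad a nu) b = pairing nu (lie_bracket G a b).
Proof.
pose phi (c : lieAlg R n) : R^o := pairing nu (lie_bracket G a c).
have phi_lin : linear phi.
  by move=> k u v; rewrite /phi lie_bracket_linr pairing_linr.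
pose P : {linear lieAlg R n -> R^o} :=
  HB.pack phi (GRing.isLinear.Build _ _ _ _ _ phi_lin).
rewrite pairingE -[RHS]/(P b) [in RHS](row_sum_delta b) linear_sum.
by apply: eq_bigr => i _; rewrite linearZ mxE.
Qed.

(** The component along the linear factors of the Hamiltonian field in [ham_proj]. *)
Definition redham h w : W := (- d_xi h w, (d_mu h w, coad (d_nu h w) w.2.2)).

Let mu_lin : linear (fun v : lieDual R n => (v, (0, 0)) : W).
Proof.
by move=> a u v; apply: injective_projections;
  [|apply: injective_projections]; rewrite /= ?scaler0 ?addr0.
Qed.

Let xi_lin : linear (fun v : lieAlg R n => (0, (v, 0)) : W).
Proof.
by move=> a u v; apply: injective_projections;
  [|apply: injective_projections]; rewrite /= ?scaler0 ?addr0.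
Qed.

Let nu_lin : linear (fun v : lieDual R n => (0, (0, v)) : W).
Proof.
by move=> a u v; apply: injective_projections;
  [|apply: injective_projections]; rewrite /= ?scaler0 ?addr0.
Qed.

Lemma derive_mu h w v : differentiable h w ->
  'D_(v, (0, 0)) h w = pairing v (d_mu h w).
Proof.
move=> dh; rewrite (derive_sum_delta v mu_lin dh) pairingE.
by apply: eq_bigr => i _; rewrite big_ord1 mxE mulrC.
Qed.

Lemma derive_xi h w v : differentiable h w ->
  'D_(0, (v, 0)) h w = pairing (d_xi h w) v.
Proof.
move=> dh; rewrite (derive_sum_delta v xi_lin dh) pairingE big_ord1.
by apply: eq_bigr => i _; rewrite mxE.
Qed.

Lemma derive_nu h w v : differentiable h w ->
  'D_(0, (0, v)) h w = pairing v (d_nu h w).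
Proof.
move=> dh; rewrite (derive_sum_delta v nu_lin dh) pairingE.
by apply: eq_bigr => i _; rewrite big_ord1 mxE mulrC.
Qed.

Lemma derive_split h w (v : W) : differentiable h w ->
  'D_v h w = 'D_(v.1, (0, 0)) h w + 'D_(0, (v.2.1, 0)) h w
             + 'D_(0, (0, v.2.2)) h w.
Proof.
move=> dh; have l := derive_lin dh.
have D (x y : W) : 'D_(x + y) h w = 'D_x h w + 'D_y h w.
  by have := l 1 x y; rewrite !scale1r.
rewrite -!D; congr ('D_ _ h w).
case: v => a [b c]; apply: injective_projections => /=.
  by rewrite !addr0.
by apply: injective_projections; rewrite /= ?addr0 ?add0r.
Qed.

Lemma derive_pairing h w (v : W) : differentiable h w ->
  'D_v h w = pairing v.1 (d_mu h w) + pairing (d_xi h w) v.2.1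
             + pairing v.2.2 (d_nu h w).
Proof.
move=> dh; rewrite derive_split // derive_mu // derive_xi //.
by rewrite derive_nu.
Qed.

(** Presents the bracket as the derivative of [k] along a vector field depending on [h]; the Leibniz
    rule and the Jacobi identity are proved in this form. *)
Lemma reduced_bracketE h k w : differentiable k w ->
  reduced_bracket G h k w = 'D_(redham h w) k w.
Proof.
move=> dk; rewrite derive_pairing // pairingNl pairing_coad /reduced_bracket.
by rewrite [- _ + _]addrC.
Qed.

Lemma reduced_bracketC h k :
  reduced_bracket G h k = (fun w => - reduced_bracket G k h w).
Proof.
apply/funext => w; rewrite /reduced_bracket lie_bracketC pairingNr.
by rewrite !opprD opprK [- pairing _ _ + _]addrC.
Qed.

Let nu_continuous : continuous (fun w : W => w.2.2).
Proof. by move=> w; apply: (cvg_comp snd snd); exact: cvg_snd. Qed.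


Let nu_pairing_linear (a : lieAlg R n) :
  linear (fun y : W => pairing y.2.2 a : R^o).
Proof. by move=> c u v; rewrite /= -pairing_linl. Qed.

Lemma smooth_at_nu_pairing (a : lieAlg R n) w :
  smooth_at w (fun y : W => pairing y.2.2 a).
Proof.
have -> : (fun y : W => pairing y.2.2 a) = (fun y => \sum_i a 0 i * y.2.2 i 0).
  by apply/funext => y; rewrite pairingE.
apply: smooth_at_sum => i; apply: smooth_atM; first exact: smooth_at_cst.
apply: smooth_at_linear => [c u v|y]; first by rewrite /= !mxE.
apply: (cvg_comp (fun w : W => w.2.2) (fun N : lieDual R n => N i 0)).
  exact: nu_continuous.
exact: coord_continuous.
Qed.

Let nu_pairing_continuous (a : lieAlg R n) :
  continuous (fun y : W => pairing y.2.2 a).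
Proof.
move=> y; apply: differentiable_continuous; apply: smooth_at_differentiable.
exact: smooth_at_nu_pairing.
Qed.

(** With structure constants the pairing becomes polynomial in the coordinates of [a] and [b], which
    gives smoothness when these are derivatives. *)
Lemma pairing_bracketE nu a b : pairing nu (lie_bracket G a b) =
  \sum_i \sum_l b 0 i * (a 0 l *
    pairing nu (lie_bracket G (delta_mx 0 l) (delta_mx 0 i))).
Proof.
rewrite -pairing_coad pairingE; apply: eq_bigr => i _; rewrite mxE -mulr_sumr.
congr (_ * _); rewrite lie_bracketC pairingNr -pairing_coad pairingE -sumrN.
by apply: eq_bigr => l _; rewrite mxE -mulrN -pairingNr -lie_bracketC.
Qed.

Lemma smooth_at_reduced_bracket h k w : smooth_at w h -> smooth_at w k ->
  smooth_at w (reduced_bracket G h k).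
Proof.
move=> sh sk; have hkE : reduced_bracket G h k = fun y =>
  (\sum_i 'D_((delta_mx i 0, (0, 0)) : W) h y
          * 'D_((0, (delta_mx 0 i, 0)) : W) k y
  - \sum_i 'D_((delta_mx i 0, (0, 0)) : W) k y
          * 'D_((0, (delta_mx 0 i, 0)) : W) h y)
  + \sum_i \sum_l 'D_((0, (0, delta_mx i 0)) : W) k y *
     ('D_((0, (0, delta_mx l 0)) : W) h y
      * pairing y.2.2 (lie_bracket G (delta_mx 0 l) (delta_mx 0 i))).
  apply/funext => y; rewrite /reduced_bracket pairing_bracketE.
  congr (_ - _ + _); rewrite ?[LHS]pairingE.
  - by apply: eq_bigr => i _; rewrite !mxE.
  - by apply: eq_bigr => i _; rewrite !mxE.
  - by apply: eq_bigr => i _; apply: eq_bigr => l _; rewrite !mxE.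
rewrite hkE.
have D f v : smooth_at w f -> smooth_at w ('D_v f) by exact: smooth_at_derive.
apply: smooth_atD.
  apply: smooth_atD; last apply: smooth_atN.
    by apply: smooth_at_sum => i; apply: smooth_atM; exact: D.
  by apply: smooth_at_sum => i; apply: smooth_atM; exact: D.
apply: smooth_at_sum => i; apply: smooth_at_sum => l.
apply: smooth_atM; first exact: D.
by apply: smooth_atM; [exact: D|exact: smooth_at_nu_pairing].
Qed.

(** [is_diff_derive_along] treats directions in one block of matrices, so [v] is cut into its
    components in the three factors of [W]. *)
Lemma is_diff_derive_field (v dv : W -> W) k w :
  (forall p, smooth_at p k) ->
  is_diff w (fun y => (v y).1) (fun u => (dv u).1) ->
  is_diff w (fun y => (v y).2.1) (fun u => (dv u).2.1) ->
  is_diff w (fun y => (v y).2.2) (fun u => (dv u).2.2) ->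
  is_diff w (fun y => 'D_(v y) k y)
    (fun u => 'D_u ('D_(v w) k) w + 'D_(dv u) k w).
Proof.
move=> sk d1 d2 d3.
have dk vs p : differentiable (dderiv k vs) p by exact: smooth_at_diff.
have i1 := is_diff_derive_along mu_lin (sk w) (is_diff_id w) d1.
have i2 := is_diff_derive_along xi_lin (sk w) (is_diff_id w) d2.
have i3 := is_diff_derive_along nu_lin (sk w) (is_diff_id w) d3.
have split3 x y : 'D_x k y = 'D_(x.1, (0, 0)) k y + 'D_(0, (x.2.1, 0)) k y
    + 'D_(0, (0, x.2.2)) k y.
  by apply: derive_split; exact: (dk [::]).
have dsum := is_diffD_fun (is_diffD_fun i1 i2) i3.
have dvk := eq_is_diff (fun y => esym (split3 (v y) y)) dsum.
apply: (is_diff_eq dvk); apply/funext => u.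
have dd x : is_diff w ('D_x k) (fun u => 'D_u ('D_x k) w).
  by apply: is_diff_deriveP; exact: (dk [:: x]).
have e2 : 'D_u ('D_(v w) k) w = 'D_u ('D_((v w).1, (0, 0)) k) w
    + 'D_u ('D_(0, ((v w).2.1, 0)) k) w + 'D_u ('D_(0, (0, (v w).2.2)) k) w.
  exact: (is_diff_derive u (eq_is_diff (fun y => esym (split3 (v w) y))
    (is_diffD_fun (is_diffD_fun (dd _) (dd _)) (dd _)))).
have alg (a b c d e f : R) :
    a + d + (b + e) + (c + f) = a + b + c + (d + e + f).
  by ring.
exact: etrans (alg _ _ _ _ _ _) (esym (congr2 +%R e2 (split3 (dv u) w))).
Qed.

(** * The Jacobi identity of the reduced bracket *)

Let smoothW := fun h : W -> R => forall p, smooth_at p h.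

Let smooth_reduced h k : smoothW h -> smoothW k ->
  smoothW (reduced_bracket G h k).
Proof. by move=> sh sk p; exact: smooth_at_reduced_bracket. Qed.

Let reduced_bracketW h k : smoothW k ->
  reduced_bracket G h k = fun y => 'D_(redham h y) k y.
Proof.
move=> sk; apply/funext => y; apply: reduced_bracketE.
exact: smooth_at_differentiable.
Qed.

Lemma is_diff_col (p : nat) (E : normedModType R) (f df : 'I_p -> E -> R) x :
  (forall i, is_diff x (f i) (df i)) ->
  is_diff x (fun y => \col_i f i y) (fun u => \col_i df i u).
Proof.
move=> fx.
have cE (g : 'I_p -> E -> R) : (fun y => \col_i g i y) =
    (fun y => \sum_i g i y *: (delta_mx i 0 : 'cV[R]_p)).
  apply/funext => y; rewrite [LHS]matrix_sum_delta; apply: eq_bigr => i _.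
  by rewrite big_ord1 mxE.
rewrite !cE; apply: is_diff_sum => i.
apply: (is_diff_eq (is_diff_scale (fx i) (is_diff_cst (delta_mx i 0) x))).
by apply/funext => u /=; rewrite scaler0 add0r.
Qed.

Lemma is_diff_row (p : nat) (E : normedModType R) (f df : 'I_p -> E -> R) x :
  (forall i, is_diff x (f i) (df i)) ->
  is_diff x (fun y => \row_i f i y) (fun u => \row_i df i u).
Proof.
move=> fx.
have cE (g : 'I_p -> E -> R) : (fun y => \row_i g i y) =
    (fun y => \sum_i g i y *: (delta_mx 0 i : 'rV[R]_p)).
  apply/funext => y; rewrite [LHS]matrix_sum_delta big_ord1.
  by apply: eq_bigr => i _; rewrite mxE.
rewrite !cE; apply: is_diff_sum => i.
apply: (is_diff_eq (is_diff_scale (fx i) (is_diff_cst (delta_mx 0 i) x))).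
by apply/funext => u /=; rewrite scaler0 add0r.
Qed.

Let redham_diff h w : smoothW h -> exists dv : W -> W, [/\
  is_diff w (fun y => (redham h y).1) (fun u => (dv u).1),
  is_diff w (fun y => (redham h y).2.1) (fun u => (dv u).2.1) &
  is_diff w (fun y => (redham h y).2.2) (fun u => (dv u).2.2)].
Proof.
move=> sh.
have sd (f : W -> R) : smooth_at w f -> is_diff w f ('d f w).
  by move=> sf; apply: differentiableP; exact: smooth_at_differentiable.
pose f1 i y := 'D_((0, (delta_mx 0 i, 0)) : W) h y.
pose f2 i y := 'D_((delta_mx i 0, (0, 0)) : W) h y.
(* Coordinate [i] of [coad], with the bracket expanded by [pairing_bracketE]; the first factor is
   the basis vector in the second slot. *)
pose f3 i y := \sum_j \sum_l (delta_mx 0 i : lieAlg R n) 0 j *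
  ('D_((0, (0, delta_mx l 0)) : W) h y
      * pairing y.2.2 (lie_bracket G (delta_mx 0 l) (delta_mx 0 j))).
have D v : smooth_at w ('D_v h) by exact: smooth_at_derive.
have d1 i : is_diff w (f1 i) ('d (f1 i) w) by exact/sd/D.
have d2 i : is_diff w (f2 i) ('d (f2 i) w) by exact/sd/D.
have d3 i : is_diff w (f3 i) ('d (f3 i) w).
  apply: sd; apply: smooth_at_sum => j; apply: smooth_at_sum => l.
  apply: smooth_atM; first exact: smooth_at_cst.
  by apply: smooth_atM; [exact: D|exact: smooth_at_nu_pairing].
exists (fun u => (- \col_i 'd (f1 i) w u,
   (\row_i 'd (f2 i) w u, \col_i 'd (f3 i) w u))); split => /=.
- exact: is_diffN (is_diff_col d1).
- exact: is_diff_row d2.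
- have -> : (fun y : W => coad (d_nu h y) y.2.2) = (fun y => \col_i f3 i y).
    apply/funext => y; apply/colP => i; rewrite !mxE pairing_bracketE.
    apply: eq_bigr => j _; apply: eq_bigr => l _.
    by rewrite [d_nu h y 0 l]mxE.
  exact: is_diff_col d3.
Qed.

Definition jacobiator h k j w :=
  reduced_bracket G h (reduced_bracket G k j) w
  + reduced_bracket G k (reduced_bracket G j h) w
  + reduced_bracket G j (reduced_bracket G h k) w.

(* The second derivatives of [j] cancel in the Jacobiator, which is thus a
   derivation in each of its arguments. *)
Lemma jacobiator_derivation h k w : smoothW h -> smoothW k ->
  exists Z : W, forall j, smoothW j -> jacobiator h k j w = 'D_Z j w.
Proof.
move=> sh sk.
have [dh [h1 h2 h3]] := redham_diff w sh.
have [dk [k1 k2 k3]] := redham_diff w sk.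
pose hk := reduced_bracket G h k.
(* The direction is the Jacobi-Lie bracket of [redham h] and [redham k] minus [redham hk]. *)
exists (dk (redham h w) + (-1) *: (dh (redham k w) + redham hk w)) => j sj.
have dj : differentiable j w by exact: smooth_at_differentiable.
have lj := derive_lin dj.
have e1 : reduced_bracket G h (reduced_bracket G k j) w =
    'D_(redham h w) ('D_(redham k w) j) w + 'D_(dk (redham h w)) j w.
  rewrite (reduced_bracketW h (smooth_reduced sk sj)) (reduced_bracketW k sj).
  exact: is_diff_derive (is_diff_derive_field sj k1 k2 k3).
have e2 : reduced_bracket G k (reduced_bracket G j h) w =
    - ('D_(redham k w) ('D_(redham h w) j) w + 'D_(dh (redham k w)) j w).
  rewrite (reduced_bracketW k (smooth_reduced sj sh)) (reduced_bracketC j).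
  rewrite (reduced_bracketW h sj).
  have d := is_diff_derive_field sj h1 h2 h3.
  exact: (is_diff_derive (redham k w) (is_diffN d)).
have e3 : reduced_bracket G j (reduced_bracket G h k) w =
    - 'D_(redham hk w) j w.
  by rewrite reduced_bracketC (reduced_bracketW _ sj).
have e4 := deriveC_real (redham h w) (redham k w) (sj w).
have e5 : 'D_(dk (redham h w) + (-1) *: (dh (redham k w) + redham hk w)) j w
  = 'D_(dk (redham h w)) j w
    - ('D_(dh (redham k w)) j w + 'D_(redham hk w) j w).
  rewrite addrC; apply: etrans (lj _ _ _) _.
  have := lj 1 (dh (redham k w)) (redham hk w); rewrite !scale1r => ->.
  by rewrite scaleN1r addrC.
have alg (A B a b c : R) : B = A -> A + a - (B + b) - c = a - (b + c).
  by move=> ->; ring.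
exact: etrans (congr2 +%R (congr2 +%R e1 e2) e3)
  (etrans (alg _ _ _ _ _ e4) (esym e5)).
Qed.

(** The witness is the differential of [h] at [w]. It has the same first derivatives at [w] as [h],
    and these are all that a derivation sees. *)
Let linear_part h w : smoothW h -> exists l : W -> R,
  [/\ smoothW l, forall v, 'D_v l w = 'D_v h w & forall v y, 'D_v l y = l v].
Proof.
move=> sh; have dh : differentiable h w by exact: smooth_at_differentiable.
have ll : linear ('d h w) by move=> a u v; exact: linearP.
have lc : continuous ('d h w) by exact: diff_continuous.
have ld v y : 'D_v ('d h w) y = 'd h w v.
  exact: is_diff_derive (is_diff_linear y ll lc).
exists ('d h w); split => [p|v|//]; first exact: smooth_at_linear.
by rewrite ld deriveE.
Qed.

Let jacobiator_eq h k j j' w : smoothW h -> smoothW k -> smoothW j ->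
  smoothW j' -> (forall v, 'D_v j' w = 'D_v j w) ->
  jacobiator h k j w = jacobiator h k j' w.
Proof.
move=> sh sk sj sj' jj'; have [Z ZE] := jacobiator_derivation w sh sk.
by rewrite !ZE // jj'.
Qed.

Let jacobiator_rot h k j w : jacobiator h k j w = jacobiator k j h w.
Proof.
have rot (a b c : R) : a + b + c = b + c + a by ring.
exact: rot.
Qed.

(** Partial derivatives of linear functions are constant, so the inner bracket is a constant plus
    the pairing of [nu] with an element of the Lie algebra. Only its [nu] derivative survives, and
    the sum reduces to [lie_bracket_jacobi]. *)
Let jacobiator_linear h k j w :
  (forall v y, 'D_v h y = h v) -> (forall v y, 'D_v k y = k v) ->
  (forall v y, 'D_v j y = j v) -> jacobiator h k j w = 0.
Proof.
have muE (f : W -> R) (fl : forall v y, 'D_v f y = f v) y : d_mu f y = d_mu f w.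
  by apply/rowP => i; rewrite !mxE !fl.
have xiE (f : W -> R) (fl : forall v y, 'D_v f y = f v) y : d_xi f y = d_xi f w.
  by apply/colP => i; rewrite !mxE !fl.
have nuE (f : W -> R) (fl : forall v y, 'D_v f y = f v) y : d_nu f y = d_nu f w.
  by apply/rowP => i; rewrite !mxE !fl.
have key (f g l : W -> R) : (forall v y, 'D_v f y = f v) ->
    (forall v y, 'D_v g y = g v) -> (forall v y, 'D_v l y = l v) ->
    reduced_bracket G f (reduced_bracket G g l) w =
    pairing w.2.2
      (lie_bracket G (d_nu f w) (lie_bracket G (d_nu g w) (d_nu l w))).
  move=> fl gl hl.
  pose c := pairing (d_xi l w) (d_mu g w) - pairing (d_xi g w) (d_mu l w).
  pose b := lie_bracket G (d_nu g w) (d_nu l w).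
  have glE : reduced_bracket G g l = cst c + (fun y => pairing y.2.2 b).
    apply/funext => y; rewrite /reduced_bracket.
    by rewrite !(muE, xiE, nuE).
  have dgl v y : 'D_v (reduced_bracket G g l) y = pairing v.2.2 b.
    have d := is_diff_linear y (nu_pairing_linear b) (@nu_pairing_continuous b).
    by rewrite glE (is_diff_derive v (is_diffD (is_diff_cst c y) d)) /= add0r.
  rewrite [LHS]/reduced_bracket.
  have -> : d_xi (reduced_bracket G g l) w = 0.
    by apply/colP => i; rewrite mxE dgl pairing0l mxE.
  have -> : d_mu (reduced_bracket G g l) w = 0.
    by apply/rowP => i; rewrite mxE dgl pairing0l mxE.
  have -> : d_nu (reduced_bracket G g l) w = b.
    by apply/rowP => i; rewrite [LHS]mxE dgl pairing_delta.
  by rewrite pairing0l pairing0r subrr add0r.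
move=> hl kl jl; rewrite /jacobiator !key //.
have D mu (a b : lieAlg R n) : pairing mu a + pairing mu b = pairing mu (a + b).
  by have := pairing_linr mu 1 a b; rewrite scale1r mul1r.
by rewrite !D lie_bracket_jacobi pairing0r.
Qed.

Lemma reduced_bracket_jacobi h k j w : smoothW h -> smoothW k -> smoothW j ->
  jacobiator h k j w = 0.
Proof.
move=> sh sk sj.
have [h' [sh' hh' hl]] := linear_part w sh.
have [k' [sk' kk' kl]] := linear_part w sk.
have [j' [sj' jj' jl]] := linear_part w sj.
(* The derivation property concerns the last slot; cyclic rotation brings each argument there in
   turn. *)
rewrite (jacobiator_eq sh sk sj sj' jj') jacobiator_rot.
rewrite (jacobiator_eq sk sj' sh sh' hh') jacobiator_rot.
rewrite (jacobiator_eq sj' sh' sk sk' kk').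
exact: jacobiator_linear.
Qed.

Lemma smooth_fun_spaceP h : smooth_fun (h : space_mfd W -> R) <-> smoothW h.
Proof.
split=> [[_ sh] p|sh]; first exact: sh p.
split=> p; last exact: sh p.
by apply: differentiable_continuous; exact: smooth_at_differentiable.
Qed.

Lemma reduced_poisson :
  poisson_bracket (M := space_mfd W) (@reduced_bracket R n G).
Proof.
split.
- move=> h k /smooth_fun_spaceP sh /smooth_fun_spaceP sk.
  by apply/smooth_fun_spaceP; exact: smooth_reduced.
- move=> a h h' k /smooth_fun_spaceP sh /smooth_fun_spaceP sh'
    /smooth_fun_spaceP sk.
  have dh w : differentiable h w by exact: smooth_at_differentiable.
  have dh' w : differentiable h' w by exact: smooth_at_differentiable.
  (* Antisymmetry puts the combination in the second slot, where the bracket is a derivative. *)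
  rewrite (reduced_bracketC h) (reduced_bracketC h') (reduced_bracketC _ k).
  apply/funext => w; rewrite !reduced_bracketE //.
    set V := redham k w.
    have d := is_diffD (is_diffZ a (differentiableP (dh w)))
      (differentiableP (dh' w)).
    rewrite [X in - X = _](is_diff_derive V d) /= !deriveE //.
    by rewrite opprD mulrN.
  exact: (differentiableD (differentiableZ a (dh w)) (dh' w)).
- by move=> h k _ _; exact: reduced_bracketC.
- move=> h k k' /smooth_fun_spaceP sh /smooth_fun_spaceP sk
    /smooth_fun_spaceP sk'.
  have dk w : differentiable k w by exact: smooth_at_differentiable.
  have dk' w : differentiable k' w by exact: smooth_at_differentiable.
  have alg (x y a b : R) : x *: b + y *: a = a * y + x * b :> R.
    by rewrite addrC [y *: a]mulrC.
  apply/funext => w.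
  apply: etrans (reduced_bracketE h (differentiableM (dk w) (dk' w))) _.
  apply: etrans _ (esym (congr2 (fun x y => x * k' w + k w * y)
    (reduced_bracketE h (dk w)) (reduced_bracketE h (dk' w)))).
  apply: etrans (alg _ _ _ _).
  exact: deriveM (diff_derivable (dk w)) (diff_derivable (dk' w)).
- move=> h k j /smooth_fun_spaceP sh /smooth_fun_spaceP sk
    /smooth_fun_spaceP sj p.
  exact: reduced_bracket_jacobi.
Qed.

End ReducedBracket.

(** * The Tulczyjew form and its reduction *)

Lemma continuous_pair (T U V : topologicalType) (f : T -> U) (g : T -> V) x :
  {for x, continuous f} -> {for x, continuous g} ->
  {for x, continuous (fun y => (f y, g y))}.
Proof. by move=> cf cg; apply: cvg_pair. Qed.

Section Tulczyjew.
Context (R : realType) (n : nat) (G : lieGroup R n).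
Let W := redSpace R n.
Let TT := TTstar G.
Local Notation Omega := (@tulczyjew R n G).
Implicit Types (H K : TT -> R) (p : TT).

(** * Nondegeneracy and Hamiltonian fields *)

Lemma rinv_field_linear (g : G) :
  linear ((fun a => rinv_field a g) : lieAlg R n -> lieAlg R n).
Proof. by move=> a u v; exact: tmap_linear. Qed.

Lemma lie_bracketr0 (a : lieAlg R n) : lie_bracket G a 0 = 0.
Proof.
have := lie_bracket_linr G a 1 0 0; rewrite !scale1r addr0 => e.
by apply: (addrI (lie_bracket G a 0)); rewrite addr0 -e.
Qed.

Lemma rtriv0 (g : G) : rtriv G g (0 : 'rV[R]_n) = 0.
Proof. exact: linear0. Qed.

Lemma linear_expand k l (E : lmodType R) (phi : E -> R^o)
    (iota : 'M[R]_(k, l) -> E) (v : 'M[R]_(k, l)) : linear phi -> linear iota ->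
  phi (iota v) = \sum_i \sum_j v i j * phi (iota (delta_mx i j)).
Proof.
move=> lphi li.
pose g : {linear 'M[R]_(k, l) -> E} :=
  HB.pack iota (GRing.isLinear.Build _ _ _ _ _ li).
pose f : {linear E -> R^o} := HB.pack phi (GRing.isLinear.Build _ _ _ _ _ lphi).
rewrite -[LHS]/(f (g v)) [in LHS](matrix_sum_delta v) !linear_sum.
apply: eq_bigr => i _; rewrite !linear_sum; apply: eq_bigr => j _.
by rewrite !linearZ.
Qed.

(** Testing on vectors tangent to one factor at a time isolates one component each. *)
Lemma tulczyjew_inj p (X Y : tangent p) :
  (forall v : tangent p, Omega X v = Omega Y v) -> X = Y.
Proof.
case: p X Y => g [mu [xi nu]] [x [x1 [x2 x3]]] [y [y1 [y2 y3]]] XY.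
have pd (a : lieDual R n) i : pairing a (delta_mx 0 i) = a i 0.
  rewrite pairingE (bigD1 i) //= big1 ?addr0 ?mxE ?eqxx ?mul1r // => l li.
  by rewrite mxE (negPf li) mul0r.
have xy : rtriv G g x = rtriv G g y.
  apply/rowP => i; have := XY (0, (0, (0, delta_mx i 0))) => /=.
  by rewrite !rtriv0 !lie_bracketr0 !pairing0r !pairing0l !pairing_delta; lra.
have -> : x = y.
  exact: etrans (esym (@rinv_field_rtriv R n G g x)) (etrans
    (congr1 (fun a => rinv_field a g) xy) (@rinv_field_rtriv R n G g y)).
have -> : x2 = y2.
  apply/rowP => i; have := XY (0, (delta_mx i 0, (0, 0))) => /=.
  by rewrite !rtriv0 !lie_bracketr0 !pairing0r !pairing0l !pairing_delta; lra.
have -> : x1 = y1.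
  apply/colP => i; have := XY (0, (0, (delta_mx 0 i, 0))) => /=.
  by rewrite !rtriv0 !lie_bracketr0 !pairing0r !pairing0l !pd; lra.
(* Vectors tangent to [G] are tested last: their bracket term contains the [G] components, equal by
   [xy]. *)
have -> // : x3 = y3.
apply/colP => i; have := XY (rinv_field (delta_mx 0 i) g, (0, (0, 0))) => /=.
by rewrite !rtriv_rinv_field !pd xy !pairing0r !pairing0l; lra.
Qed.

Lemma tulczyjew_sol p (l : tangent p -> R^o) :
  linear (l : 'rV[R]_n * W -> R^o) ->
  exists X : tangent p, forall v : tangent p, Omega X v = - l v.
Proof.
case: p l => g [mu [xi nu]] l ll.
(* Each component is read off [l] on the factor paired with it; the term [coad G a nu] in [x3]
   offsets the bracket term of the form. *)
pose a : lieAlg R n := \row_i l (0, (0, (0, delta_mx i 0))).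
pose x1 : lieDual R n := - \col_i l (0, (0, (delta_mx 0 i, 0))).
pose x2 : lieAlg R n := \row_i l (0, (delta_mx i 0, (0, 0))).
pose x3 : lieDual R n :=
  coad G a nu - \col_i l (rinv_field (delta_mx 0 i) g, (0, (0, 0))).
exists (rinv_field a g, (x1, (x2, x3))) => -[y [y1 [y2 y3]]] /=.
rewrite rtriv_rinv_field; set b := rtriv G g y.
have yE : y = rinv_field b g by rewrite rinv_field_rtriv.
have lD u v : l (u + v) = l u + l v.
  by have := ll 1 u v; rewrite !scale1r.
have -> : l (y, (y1, (y2, y3))) = l (y, (0, (0, 0))) + l (0, (y1, (0, 0)))
    + l (0, (0, (y2, 0))) + l (0, (0, (0, y3))).
  by rewrite -!lD; congr (l _); apply: injective_projections;
    [|apply: injective_projections; [|apply: injective_projections]];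
    rewrite /= ?addr0 ?add0r.
have -> : l (y, (0, (0, 0))) =
    pairing (\col_i l (rinv_field (delta_mx 0 i) g, (0, (0, 0)))) b.
  rewrite yE pairingE.
  pose io (c : 'rV[R]_n) : 'rV[R]_n * W := (rinv_field c g, (0, (0, 0))).
  have li : linear io.
    move=> c u v; apply: injective_projections => /=.
      exact: rinv_field_linear.
    by apply: injective_projections;
      [|apply: injective_projections]; rewrite /= ?scaler0 ?addr0.
  rewrite -[LHS]/(l (io b)) (linear_expand b ll li) big_ord1.
  by apply: eq_bigr => i _; rewrite mxE.
have -> : l (0, (y1, (0, 0))) = pairing y1 x2.
  pose io (c : 'cV[R]_n) : 'rV[R]_n * W := (0, (c, (0, 0))).
  have li : linear io.
    by move=> c u v; apply: injective_projections;
      [|apply: injective_projections; [|apply: injective_projections]];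
      rewrite /= ?scaler0 ?addr0.
  rewrite -[LHS]/(l (io y1)) (linear_expand y1 ll li) pairingE.
  by apply: eq_bigr => i _; rewrite big_ord1 mxE mulrC.
have -> : l (0, (0, (y2, 0))) = - pairing x1 y2.
  pose io (c : 'rV[R]_n) : 'rV[R]_n * W := (0, (0, (c, 0))).
  have li : linear io.
    by move=> c u v; apply: injective_projections;
      [|apply: injective_projections; [|apply: injective_projections]];
      rewrite /= ?scaler0 ?addr0.
  rewrite -[LHS]/(l (io y2)) (linear_expand y2 ll li) pairingNl opprK.
  rewrite pairingE big_ord1.
  by apply: eq_bigr => i _; rewrite mxE.
have -> : l (0, (0, (0, y3))) = pairing y3 a.
  pose io (c : 'cV[R]_n) : 'rV[R]_n * W := (0, (0, (0, c))).
  have li : linear io.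
    by move=> c u v; apply: injective_projections;
      [|apply: injective_projections; [|apply: injective_projections]];
      rewrite /= ?scaler0 ?addr0.
  rewrite -[LHS]/(l (io y3)) (linear_expand y3 ll li) pairingE.
  by apply: eq_bigr => i _; rewrite big_ord1 mxE mulrC.
rewrite /x3.
have -> (u v : lieDual R n) : pairing (u - v) b = pairing u b - pairing v b.
  by rewrite /pairing mulmxBr !mxE.
by rewrite pairing_coad; ring.
Qed.

Lemma smooth_fun_mdiff H p : smooth_fun H -> mdiff (H : TT -> space_mfd R) p.
Proof. exact: smooth_map_mdiff. Qed.

Lemma dfun_linear H p : linear (dfun H p : 'rV[R]_n * W -> R^o).
Proof. by move=> a u v; exact: tmap_linear. Qed.

(** [ham] chooses a solution, with default 0 if there is none. Here [X] is one, and nondegeneracy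
    makes the choice equal to it. *)
Lemma ham_eq H p (X : tangent p) :
  (forall v : tangent p, Omega X v = - dfun H p v) ->
  ham (@tulczyjew R n G) H p = X.
Proof.
move=> XH; apply: (@tulczyjew_inj p) => v; rewrite XH.
rewrite /ham.
by case: xgetP => [Y _ ->|/(_ X)].
Qed.

Lemma hamP H p (v : tangent p) :
  Omega (ham (@tulczyjew R n G) H p) v = - dfun H p v.
Proof.
have [X XH] := tulczyjew_sol (dfun_linear H p).
by rewrite (ham_eq XH) XH.
Qed.

Lemma ham_unique H : exists! X : vector_field TT,
  hamiltonian_field (@tulczyjew R n G) H X.
Proof.
exists (ham (@tulczyjew R n G) H); split=> [p v|Y YH]; first exact: hamP.
by apply: functional_extensionality_dep => p; apply: ham_eq => v; exact: YH.
Qed.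

(** * Invariance under the action of the group *)

Lemma mdiff_act (h : G) p : mdiff ((@TTstar_act R n G)^~ h : TT -> TT) p /\
  forall v : tangent p, tmap ((@TTstar_act R n G)^~ h : TT -> TT) p v =
    (tmap (rtrans h) p.1 v.1, v.2).
Proof.
case: p => g w.
have [cr dr] := mdiff_rtrans g h.
have [d dE] := diff_prod_fun (z := (chart g g, w)) dr
  (@ex_diff _ _ _ _ _ _ _ (is_diff_id w)).
split; last first.
  move=> v; rewrite /tmap.
  rewrite -[RHS]/('d (local_rep (rtrans h) g) (chart g g) v.1, v.2).
  have -> : v.2 = 'd (idfun : W -> W) w v.2.
    by rewrite (is_diff_Ediff _ (is_diff_id w)).
  exact: dE.
split=> //; apply: (@continuous_pair _ _ _ (fun p : TT => rtrans h p.1) snd).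
  by apply: (cvg_comp fst (rtrans h)); [exact: cvg_fst|exact: cr].
exact: cvg_snd.
Qed.

Lemma dfun_act H (h : G) p (v : tangent p) : smooth_fun H ->
  dfun (H \o (@TTstar_act R n G)^~ h) p v =
  dfun H (TTstar_act p h) (tmap ((@TTstar_act R n G)^~ h : TT -> TT) p v).
Proof.
move=> sH.
exact: (mdiff_comp (mdiff_act h p).1 (smooth_fun_mdiff (TTstar_act p h) sH)).2.
Qed.

Lemma tulczyjew_act (h : G) p (v w : tangent p) :
  let T := tmap ((@TTstar_act R n G)^~ h : TT -> TT) p in
  tulczyjew (p := TTstar_act p h) (T v) (T w) = Omega v w.
Proof.
move=> T; rewrite /T !(mdiff_act h p).2.
case: p v w {T} => g [mu [xi nu]] [v [v1 [v2 v3]]] [w [w1 [w2 w3]]].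
by rewrite /= !rtriv_rtrans.
Qed.

(** Lets the Hamiltonian equation at the translated point be tested on translated vectors only. *)
Lemma tmap_act_surj (h : G) p (u : tangent (TTstar_act p h)) :
  exists v : tangent p, tmap ((@TTstar_act R n G)^~ h : TT -> TT) p v = u.
Proof.
exists (tmap (rtrans (linv h)) (lmul p.1 h) u.1, u.2).
rewrite (mdiff_act h p).2 /=; apply: injective_projections => //=.
have := @tmap_rtransM R n G (lmul p.1 h) (linv h) h u.1.
by rewrite lmulVg tmap_rtrans1 -lmulA lmulgV lmulg1.
Qed.

(** Naturality: since the form is invariant, the translated field solves the Hamiltonian equation at
    the translated point, and the solution is unique. *)
Lemma ham_act H (h : G) p : smooth_fun H ->
  ham (@tulczyjew R n G) H (TTstar_act p h) =
  tmap ((@TTstar_act R n G)^~ h : TT -> TT) p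
    (ham (@tulczyjew R n G) (H \o (@TTstar_act R n G)^~ h) p).
Proof.
move=> sH; apply: ham_eq => u; have [v <-] := tmap_act_surj u.
apply: etrans (tulczyjew_act _ _ _) _.
by rewrite hamP dfun_act.
Qed.

Lemma symplectic_bracket_act H K (h : G) : smooth_fun H -> smooth_fun K ->
  symplectic_bracket (@tulczyjew R n G) (H \o (@TTstar_act R n G)^~ h)
    (K \o (@TTstar_act R n G)^~ h)
  = symplectic_bracket (@tulczyjew R n G) H K \o (@TTstar_act R n G)^~ h.
Proof.
move=> sH sK; apply/funext => p.
rewrite /symplectic_bracket /= dfun_act //.
exact: (congr1 (dfun K (TTstar_act p h)) (esym (ham_act h p sH))).
Qed.

Lemma TTstar_actP : right_action (M := TT) (@TTstar_act R n G).
Proof.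
have [cm sm] := lmul_smooth G.
split; last 2 first.
- by case=> g w; rewrite /TTstar_act lmulg1.
- by move=> p g h; rewrite /TTstar_act /= lmulA.
split=> [z|[[g w] h]].
  apply: (@continuous_pair _ _ _ (fun z : prod_mfd TT G => lmul z.1.1 z.2)
    (fun z => z.1.2)); last first.
    by apply: (cvg_comp fst snd); [exact: cvg_fst|exact: cvg_snd].
  apply: (cvg_comp (fun z : prod_mfd TT G => (z.1.1, z.2) : G * G)
    (fun q => lmul q.1 q.2)); last exact: (cm (z.1.1, z.2)).
  apply: (@continuous_pair _ _ _ (fun z : prod_mfd TT G => z.1.1) snd).
    by apply: (cvg_comp fst fst); exact: cvg_fst.
  exact: cvg_snd.
(* Reordering the coordinates by the linear map [L] turns the action into the product of the group
   law and the identity. *)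
pose L (x : ('rV[R]_n * W) * 'rV[R]_n) : ('rV[R]_n * 'rV[R]_n) * W :=
  ((x.1.1, x.2), x.1.2).
have Ll : linear L by [].
have Lc : continuous L.
  move=> x; apply: (@continuous_pair _ _ _ (fun x => (x.1.1, x.2))
    (fun x => x.1.2)); last first.
    by apply: (cvg_comp fst snd); [exact: cvg_fst|exact: cvg_snd].
  apply: (@continuous_pair _ _ _ (fun x => x.1.1) snd); last exact: cvg_snd.
  by apply: (cvg_comp fst fst); exact: cvg_fst.
pose mg := local_rep (M := prod_mfd G G) (N := G)
  (fun q => lmul q.1 q.2) (g, h).
have sL : smooth_at (((chart g g, w), chart h h) : ('rV[R]_n * W) * 'rV[R]_n)
    (prod_fun mg (idfun : W -> W) \o L).
  apply: (@smooth_at_comp_affine _ _ _ _ _ L L) => [y|].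
    exact: is_diff_linear.
  by apply: smooth_at_prod_fun; [exact: (sm (g, h))|exact: smooth_at_id].
exact: sL.
Qed.

(** * Functions that factor through the projection *)

Let is_diff_snd (x : 'rV[R]_n * W) :
  is_diff x (snd : 'rV[R]_n * W -> W) (snd : 'rV[R]_n * W -> W).
Proof. by apply: is_diff_linear => // y; exact: cvg_snd. Qed.

Lemma TTstar_proj_smooth : smooth_map (@TTstar_proj R n G).
Proof.
split=> [p|p]; first exact: cvg_snd.
apply: (@smooth_at_comp_affine _ _ _ _ (idfun : W -> W) snd snd) => //.
exact: smooth_at_id.
Qed.

Lemma tmap_proj p (v : tangent p) : tmap (@TTstar_proj R n G) p v = v.2.
Proof. exact: (is_diff_Ediff v (is_diff_snd _)). Qed.

Lemma smooth_fun_proj (h : W -> R) : (forall w, smooth_at w h) ->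
  smooth_fun (M := TT) (h \o @TTstar_proj R n G).
Proof.
move=> sh; split=> p.
  have ch : {for p.2, continuous h}.
    by apply: differentiable_continuous; exact: smooth_at_differentiable.
  by apply: (cvg_comp snd h); [exact: cvg_snd|exact: ch].
exact: (@smooth_at_comp_affine _ _ _ _ h snd snd).
Qed.

Lemma dfun_proj (h : W -> R) p (v : tangent p) : differentiable h p.2 ->
  dfun (h \o @TTstar_proj R n G) p v = 'D_(v.2) h p.2.
Proof.
move=> dh; have d := @is_diff_comp _ _ _ _ snd snd h
  (fun u => 'D_u h p.2) (chart p p) (is_diff_snd _) (is_diff_deriveP dh).
exact: (is_diff_Ediff v d).
Qed.

Lemma ham_proj (h : W -> R) p : differentiable h p.2 ->
  ham (@tulczyjew R n G) (h \o @TTstar_proj R n G) p =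
  (rinv_field (d_nu h p.2) p.1, redham G h p.2).
Proof.
move=> dh; apply: ham_eq => v; rewrite dfun_proj // derive_pairing //.
case: p v dh => g [mu [xi nu]] [v [v1 [v2 v3]]] dh /=.
rewrite rtriv_rinv_field pairing_coad pairingNl.
(* [x] is the pairing of [nu] with the bracket; it comes once from [coad] and once from the form,
   and cancels. *)
have alg (x y z t : R) : x - y - x - z - t = - (t + z + y) by ring.
exact: alg.
Qed.

Lemma symplectic_bracket_proj (h k : W -> R) :
  (forall w, smooth_at w h) -> (forall w, smooth_at w k) ->
  symplectic_bracket (@tulczyjew R n G) (h \o @TTstar_proj R n G)
    (k \o @TTstar_proj R n G)
  = reduced_bracket G h k \o @TTstar_proj R n G.
Proof.
move=> sh sk; apply/funext => p.
have dh : differentiable h p.2 by exact: smooth_at_differentiable.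
have dk : differentiable k p.2 by exact: smooth_at_differentiable.
rewrite /symplectic_bracket dfun_proj // ham_proj //=.
exact: esym (reduced_bracketE G h dk).
Qed.

(** For an invariant [H] this restriction to the slice over the identity is the function induced on
    the quotient. The slice is affine in the charts. *)
Lemma smooth_at_slice H (w : W) : smooth_fun H ->
  smooth_at w (fun w => H (lone, w)).
Proof.
move=> [_ /(_ (lone, w)) sH].
pose x0 : 'rV[R]_n := chart (lone : G) lone.
have du y : is_diff y (fun w : W => (x0, w)) (fun v => (0, v)).
  by apply: is_diff_eq.
have -> : (fun w => H (lone, w)) = local_rep (H : TT -> space_mfd R) (lone, w)
    \o (fun w => (x0, w)).
  apply/funext => y; rewrite /local_rep /= /prod_fun /= chartK //.
  exact: mem_cdom.
exact: smooth_at_comp_affine du sH.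
Qed.

End Tulczyjew.

Theorem proposition6p2 (R : realType) (n : nat) (G : lieGroup R n) :
  (forall H : TTstar G -> R, smooth_fun H ->
     exists! X : vector_field (TTstar G), hamiltonian_field (@tulczyjew R n G) H X) /\
  poisson_reduction (symplectic_bracket (@tulczyjew R n G))
    (@TTstar_act R n G) (@TTstar_proj R n G) (@reduced_bracket R n G).
Proof.
split=> [H _|]; first exact: ham_unique.
split.
- exact: TTstar_actP.
- by move=> g H K; exact: symplectic_bracket_act.
- exact: TTstar_proj_smooth.
- by move=> w; exists (lone, w).
- by move=> p w; exists (0, w); exact: tmap_proj.
- move=> [g w] [g' w']; split=> [/= ww|[h [_ ->]] //].
  exists (lmul (linv g) g').
  by rewrite /TTstar_act /= lmulA lmulgV lmul1g ww.
- move=> H; split=> [[sH iH]|[h /smooth_fun_spaceP sh ->]].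
    exists (fun w => H (lone, w)).
      by apply/smooth_fun_spaceP => w; exact: smooth_at_slice.
    apply/funext => -[g w] /=.
    (* Acting by the inverse of [g] moves [(g, w)] to the slice over the identity. *)
    by rewrite -(iH (g, w) (linv g)) /TTstar_act /= lmulgV.
  by split=> //; exact: smooth_fun_proj.
- exact: reduced_poisson.
- move=> h k /smooth_fun_spaceP sh /smooth_fun_spaceP sk.
  exact: symplectic_bracket_proj.
Qed.
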